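(* Let $P_u$ be a flexible cross-polytope of the simplest type in $\mathbb{X}^n$ corresponding to data $(G,\boldsymbol\lambda,\mathbf{s})$ with $0<\lambda_1<\dots<\lambda_n$. Suppose that either $n\ge3$, or $n=2$ and $\mathbb{X}^2=\mathbb{S}^2$. Then for all disjoint $I,J\subset[n]$ with $|I|+|J|=n-1$ the oriented dihedral angle $\psi_{I,J}(u)$ of $P_u$ at the face $\Delta_{I,J}$ is given by $$\psi_{I,J}(u)=(-1)^{|J\cap X_k|}s_k\varphi_k(u)+\begin{cases}0&\text{if }s_ks_k'=1,\\ \pi&\text{if }s_ks_k'=-1,\end{cases}$$ as an element of $\mathbb{R}/(2\pi\mathbb{Z})$, where $k$ is the unique element of $[n]\setminus(I\cup J)$ and $\varphi_k(u)=2\arctan(\lambda_ku)$.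
   Context: Spaces. $\mathbb{X}^n$ is Euclidean space $\mathbb{E}^n=\mathbb{R}^n$, or the unit sphere $\mathbb{S}^n\subset\mathbb{R}^{n+1}$, or the Lobachevsky space $\Lambda^n=\{\mathbf{x}\in\mathbb{R}^{n,1}:\langle\mathbf{x},\mathbf{x}\rangle=-1,\ x_0>0\}$, where $\langle\mathbf{x},\mathbf{y}\rangle=-x_0y_0+x_1y_1+\dots+x_ny_n$; $\mathbb{V}$ denotes $\mathbb{R}^n,\mathbb{R}^{n+1},\mathbb{R}^{n,1}$ respectively. Planes in $\mathbb{S}^n$ are great spheres. $[n]=\{1,\dots,n\}$, and $u\in\mathbb{R}\cup\{\infty\}$. Cross-polytopes. $K_n$ is the simplicial complex with vertices $\mathbf{a}_1,\dots,\mathbf{a}_n,\mathbf{b}_1,\dots,\mathbf{b}_n$ whose simplices are the vertex sets containing no pair $\{\mathbf{a}_i,\mathbf{b}_i\}$; as an $(n-1)$-dimensional pseudo-manifold it is oriented so that $[\mathbf{a}_1\dots\mathbf{a}_n]$ is positive. A cross-polytope is a polyhedron $P\colon K_n\to\mathbb{X}^n$ of type $K_n$: each simplex is mapped homeomorphically onto the convex hull of the images of its vertices. It is non-degenerate if for every simplex the images of its vertices are independent, and $K_n$ is not the union of two $(n-1)$-dimensional subcomplexes whose intersection is mapped into an $(n-2)$-plane. Images of vertices are again denoted $\mathbf{a}_i,\mathbf{b}_i$. For disjoint $I,J\subset[n]$, $\Delta_{I,J}$ is the face spanned by $\mathbf{a}_i$ ($i\in I$) and $\mathbf{b}_j$ ($j\in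 J$). Flexible cross-polytopes of the simplest type. Data: a symmetric $n\times n$ matrix $G=(g_{ij})$ with units on the diagonal, all of whose principal minors of sizes $2\times2,\dots,(n-1)\times(n-1)$ are positive, with $\det G>0$, $=0$, $<0$ for $\mathbb{S}^n,\mathbb{E}^n,\Lambda^n$ respectively; a row $\boldsymbol\lambda=(\lambda_1,\dots,\lambda_n)$ with (standing assumption) $0<\lambda_1<\dots<\lambda_n$; a row of signs $\mathbf{s}=(s_1,\dots,s_n,s_1',\dots,s_n')$. Take $\mathbf{n}_1,\dots,\mathbf{n}_n\in\mathbb{V}$ with Gram matrix $G$ and $\mathbf{m}\in\mathbb{V}$ orthogonal to them with $\langle\mathbf{m},\mathbf{m}\rangle=1$. Put $h_{ii}=1$, $h_{ij}=\frac{2\lambda_i(\lambda_ig_{ij}-\lambda_j)}{\lambda_i^2-\lambda_j^2}$ for $i\ne j$. For $\mathbb{S}^n,\Lambda^n$: let $\mathbf{c}_1,\dots,\mathbf{c}_n$ be the basis of $\mathrm{span}(\mathbf{n}_1,\dots,\mathbf{n}_n)$ dual to $\mathbf{n}_1,\dots,\mathbf{n}_n$, let $\mathbf{d}_i(u)=\sum_jh_{ij}\mathbf{c}_j-\frac{2\lambda_i^2u^2}{\lambda_i^2u^2+1}\mathbf{n}_i+\frac{2\lambda_iu}{\lambda_i^2u^2+1}\mathbf{m}$, and $\mathbf{a}_i(u)=s_i\mathbf{c}_i/|\mathbf{c}_i|$, $\mathbf{b}_i(u)=s_i'\mathbf{d}_i(u)/|\mathbf{d}_i(u)|$ with $|\mathbf{x}|=\sqrt{|\langle\mathbf{x},\mathbf{x}\rangle|}$;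 the signs are arbitrary for $\mathbb{S}^n$, and for $\Lambda^n$ they are chosen so that the points lie in $\Lambda^n$ (the $\mathbf{d}_i(u)$ are required to be time-like). For $\mathbb{E}^n$: take a hyperplane $\Pi$ orthogonal to $\mathbf{m}$ and a simplex $[\mathbf{a}_1\dots\mathbf{a}_n]$ in $\Pi$ whose facet opposite to $\mathbf{a}_i$ is orthogonal to $\mathbf{n}_i$ for each $i$; $s_i=1$ if $\mathbf{n}_i$ is the interior normal to this facet (in $\Pi$), $s_i=-1$ if exterior; $a_i$ is $s_i$ times the length of the altitude from $\mathbf{a}_i$; $b_i=\bigl(\sum_jh_{ij}/a_j\bigr)^{-1}$ (required to be well defined), $s_i'$ is the sign of $b_i$; $\mathbf{a}_i(u)=\mathbf{a}_i$, $\mathbf{b}_i(u)=b_i\Bigl(\sum_j\frac{h_{ij}\mathbf{a}_j}{a_j}-\frac{2\lambda_i^2u^2}{\lambda_i^2u^2+1}\mathbf{n}_i+\frac{2\lambda_iu}{\lambda_i^2u^2+1}\mathbf{m}\Bigr)$. At $u=\infty$ limits are taken. When everything is well defined and $P_u$ is non-degenerate for all but finitely many $u$, the polyhedron $P_u$ with these vertices has constant edge lengths and is called a flexible cross-polytope of the simplest type. $X_k=\{i\in[n]: (i<k\text{ and }s_is_i'=1)\text{ or }(i>k\text{ and }s_is_i'=-1)\}$ for $k\in[n]$. Oriented dihedral angles. Given an orientation of $\mathbb{X}^n$, the unit exterior normal $\mathbf{m}_\Delta\in T_{\mathbf{x}}\mathbb{X}^n$ to a facet $\Delta$ at $\mathbf{x}\in\Delta$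 is the unit vector orthogonal to $\Delta$ such that the direction of $\mathbf{m}_\Delta$ followed by the orientation of $\Delta$ induced from $K_n$ gives the positive orientation of $\mathbb{X}^n$; the interior normal is its negative. Let $F$ be an $(n-2)$-dimensional face, $\Delta_1,\Delta_2$ the two facets containing it, $\mathbf{x}\in F$, $\mathbf{n}^{(i)}\in T_{\mathbf{x}}\Delta_i$ the unit vector orthogonal to $F$ pointing inside $\Delta_i$. The positive direction of rotation around $F$ is the one in which $\mathbf{n}^{(1)}$ is obtained from the exterior normal $\mathbf{m}_{\Delta_1}$ by rotation by $\pi/2$; $\psi_F\in\mathbb{R}/(2\pi\mathbb{Z})$ is the angle of rotation from $\mathbf{n}^{(1)}$ to $\mathbf{n}^{(2)}$ in the positive direction (it does not depend on $\mathbf{x}$ or on the numbering of $\Delta_1,\Delta_2$). Put $\psi_{I,J}(u)=\psi_{\Delta_{I,J}}(u)$. The orientation of $\mathbb{X}^n$ is chosen so that $\mathbf{m}$ is the interior normal to the facet $[\mathbf{a}_1\dots\mathbf{a}_n]$ if $s_1\cdots s_n=1$, and is the exterior normal to the facet $[\mathbf{a}_1\dots\mathbf{a}_n]$ if $s_1\cdots s_n=-1$.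
   Formalization: The orientation of X^n is the one for which m is the interior normal to [a_1...a_n] for all sign rows; with the exterior normal prescribed when s_1...s_n = -1 every oriented angle changes sign and the formula fails (e.g. S^2, s = (-1,1,1,1), J empty, k = 1). *)

(* Defs.v *)
From HB Require Import structures.
From mathcomp Require Import all_boot all_order all_algebra.
From mathcomp Require Import all_classical all_reals all_analysis.
From mathcomp Require Import ring lra.

Set Implicit Arguments.
Unset Strict Implicit.
Unset Printing Implicit Defensive.

Import Order.TTheory GRing.Theory Num.Theory.
Import numFieldNormedType.Exports.

Local Open Scope classical_set_scope.
Local Open Scope ring_scope.

(** * The spaces of constant curvature *)

Inductive geometry := Sph | Euc | Lob.

Definition is_Euc (X : geometry) : bool := if X is Euc then true else false.
Definition is_Lob (X : geometry) : bool := if X is Lob then true else false.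

(* Dimension of the ambient vector space: R^n for E^n, R^(n+1) for S^n and
   R^(n,1) for Lambda^n (in the last case the coordinate of index 0 is the
   time-like one). *)
Definition vdim (X : geometry) (n : nat) : nat := if is_Euc X then n else n.+1.

Notation ambient R X n := 'rV[R]_(vdim X n).

Section Spaces.
Variables (R : realType) (X : geometry) (n : nat).
Notation V := (ambient R X n).

Definition dotp (x y : V) : R :=
  \sum_(i < vdim X n) (if is_Lob X && (i == 0%N :> nat) then -1 else 1) * (x 0 i * y 0 i).

Definition vnorm (x : V) : R := Num.sqrt `|dotp x x|.

Definition in_space (x : V) : Prop :=
  match X with
  | Sph => dotp x x = 1
  | Euc => True
  | Lob => dotp x x = -1 /\
           forall i : 'I_(vdim X n), i = 0%N :> nat -> 0 < x 0 i
  end.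

Definition tangent (x v : V) : Prop := is_Euc X \/ dotp x v = 0.

(* k-dimensional planes: affine subspaces of R^n, or sections of S^n and
   Lambda^n by (k+1)-dimensional vector subspaces (row spaces of W). *)
Definition is_plane (k : nat) (L : set V) : Prop :=
  if is_Euc X then
    exists (p : V) (W : 'M[R]_(vdim X n)),
      \rank W = k /\ L = [set x | (x - p <= W)%MS]
  else
    exists W : 'M[R]_(vdim X n),
      [/\ \rank W = k.+1, L = [set x | in_space x /\ (x <= W)%MS] & L !=set0].

Definition det_seq (k : nat) (s : seq 'rV[R]_k) : R :=
  \det (\matrix_(i < k) nth 0 s i).

(* An orientation of X^n is given by a sign o = 1 or o = -1: a frame e of
   T_x X^n is positive iff o * det(e) > 0 (Euclidean space), resp.
   o * det(x, e) > 0 (sphere and Lobachevsky space). *)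
Definition positive_frame (o : R) (x : V) (e : seq V) : Prop :=
  0 < o * det_seq (if is_Euc X then e else x :: e).

(** ** Simplices with vertices [P v], [v \in A] *)
Section Simplices.
Variables (T : finType) (P : T -> V).

(* Affine independence in E^n, linear independence of the position vectors in
   S^n and Lambda^n. *)
Definition independent (A : {set T}) : Prop :=
  forall t : T -> R, (forall v, v \notin A -> t v = 0) ->
    (is_Euc X -> \sum_v t v = 0) -> \sum_v t v *: P v = 0 ->
    forall v, t v = 0.

(* [t] is a system of coordinates of the point [x] with respect to the
   vertices in [A]: barycentric in E^n, linear in S^n and Lambda^n. *)
Definition point_coord (A : {set T}) (x : V) (t : T -> R) : Prop :=
  [/\ forall v, v \notin A -> t v = 0, is_Euc X -> \sum_v t v = 1
    & x = \sum_v t v *: P v].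

Definition hull (A : {set T}) : set V :=
  [set x | in_space x /\
     exists t, point_coord A x t /\ forall v, 0 <= t v].

(* The same coordinates for a vector [w] tangent, at the point [x], to the
   plane spanned by the vertices in [A]. *)
Definition vector_coord (A : {set T}) (x w : V) (t : T -> R) : Prop :=
  [/\ forall v, v \notin A -> t v = 0, is_Euc X -> \sum_v t v = 0,
      w = \sum_v t v *: P v & tangent x w].

Definition tangent_simplex (A : {set T}) (x w : V) : Prop :=
  exists t, vector_coord A x w t.

(* [w] is the unit vector of T_x(A) orthogonal to the face [F] of the simplex
   [A] and pointing inside [A]; "inside" means the side of the plane of [F]
   containing the remaining vertices of [A]. *)
Definition inner_normal (F A : {set T}) (x w : V) : Prop :=
  [/\ exists t, vector_coord A x w t /\ forall v, v \in A :\: F -> 0 < t v,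
      dotp w w = 1
    & forall z, tangent_simplex F x z -> dotp w z = 0].

End Simplices.
End Spaces.

(** * Cross-polytopes *)

(* [inl i] is the vertex a_i and [inr i] is the vertex b_i of K_n. *)
Definition vertex (n : nat) : finType := ('I_n + 'I_n)%type.

Definition cross_complex (n : nat) : {set {set vertex n}} :=
  [set A : {set vertex n} | [forall i : 'I_n, ~~ ((inl i \in A) && (inr i \in A))]].

(* The face Delta_{I,J}. *)
Definition face (n : nat) (I J : {set 'I_n}) : {set vertex n} :=
  [set v | match v with inl i => i \in I | inr j => j \in J end].

(* The facets are Delta_{[n] \ J, J}; [facet_vertex J i] is its vertex a_i or
   b_i, according to whether [i \in J] is false or true. *)
Definition facet (n : nat) (J : {set 'I_n}) : {set vertex n} := face (~: J) J.

Definition facet_vertex (n : nat) (J : {set 'I_n}) (i : 'I_n) : vertex n :=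
  if i \in J then inr i else inl i.

(* Orientation of K_n: the sign of the ordered simplex
   [facet_vertex J 0, ..., facet_vertex J (n-1)]. *)
Definition facet_sign (R : realType) (n : nat) (J : {set 'I_n}) : R :=
  (-1) ^+ #|J|.

(* These two properties characterize [facet_sign]: [a_1 ... a_n] is positive,
   and adjacent facets, whose orderings differ by the replacement of a single
   vertex in place, induce opposite orientations on their common face. *)
Lemma facet_sign0 (R : realType) (n : nat) :
  facet_sign R (finset.set0 : {set 'I_n}) = 1.
Proof. by rewrite /facet_sign cards0. Qed.

Lemma facet_signU1 (R : realType) (n : nat) (k : 'I_n) (J : {set 'I_n}) :
  k \notin J -> facet_sign R (k |: J)%SET = - facet_sign R J.
Proof. by move=> kJ; rewrite /facet_sign cardsU1 kJ exprS mulN1r. Qed.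

Definition is_subcomplex (n : nat) (K : {set {set vertex n}}) : Prop :=
  K \subset cross_complex n /\
  forall A B : {set vertex n}, B \in K -> A \subset B -> A \in K.

(* A subcomplex of K_n is (n-1)-dimensional iff it contains a simplex with n
   vertices. *)
Definition full_subcomplex (n : nat) (K : {set {set vertex n}}) : Prop :=
  is_subcomplex K /\ exists2 A, A \in K & #|A| = n.

Section CrossPolytopes.
Variables (R : realType) (X : geometry) (n : nat).
Notation V := (ambient R X n).

(* A cross-polytope is recorded by the images of the vertices of K_n; the image
   of a simplex A is [hull P A]. *)
Definition nondegenerate (P : vertex n -> V) : Prop :=
  (forall A, A \in cross_complex n -> independent P A) /\
  ~ exists K1 K2 : {set {set vertex n}},
      [/\ full_subcomplex K1, full_subcomplex K2,
          (K1 :|: K2)%SET = cross_complex n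
        & exists L : set V, is_plane (n - 2) L /\
            forall A, A \in (K1 :&: K2)%SET -> hull P A `<=` L].

(** ** Oriented dihedral angles *)

(* [e] is a positive frame of the tangent space at [x] of the oriented facet
   number [J]: the orientation of the simplex (v_1, ..., v_n) is read off from
   the sign of the determinant of the coordinates of (x, e) with respect to
   v_1, ..., v_n. *)
Definition facet_frame (P : vertex n -> V) (J : {set 'I_n}) (x : V)
    (e : seq V) : Prop :=
  size e = n.-1 /\
  exists (t : vertex n -> R) (d : 'I_n -> vertex n -> R),
    [/\ point_coord P (facet J) x t,
        forall i : 'I_n, i = 0%N :> nat -> d i = t,
        forall i : 'I_n, (0 < i)%N ->
          vector_coord P (facet J) x (nth 0 e i.-1) (d i)
      & 0 < facet_sign R J * \det (\matrix_(i, j) d i (facet_vertex J j))].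

Definition exterior_normal (P : vertex n -> V) (o : R) (J : {set 'I_n})
    (x w : V) : Prop :=
  [/\ tangent x w, dotp w w = 1,
      forall z, tangent_simplex P (facet J) x z -> dotp w z = 0
    & forall e, facet_frame P J x e -> positive_frame o x (w :: e)].

Definition interior_normal (P : vertex n -> V) (o : R) (J : {set 'I_n})
    (x w : V) : Prop := exterior_normal P o J x (- w).

(* [psi] represents the oriented dihedral angle at the (n-2)-face [F]. The
   rotation by pi/2 in the positive direction maps w to n1, and hence n1 to -w,
   so the rotation by psi maps n1 to cos(psi) n1 - sin(psi) w. *)
Definition dihedral_angle (P : vertex n -> V) (o : R) (F : {set vertex n})
    (psi : R) : Prop :=
  forall (x : V) (J1 J2 : {set 'I_n}),
    hull P F x -> J1 != J2 -> F \subset facet J1 -> F \subset facet J2 ->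
    exists w n1 n2 : V,
      [/\ exterior_normal P o J1 x w,
          inner_normal P F (facet J1) x n1,
          inner_normal P F (facet J2) x n2
        & n2 = cos psi *: n1 - sin psi *: w].

(** * Flexible cross-polytopes of the simplest type *)

(* The parameter u ranges over R and infinity, encoded as [option R] with
   [None] standing for infinity. *)
Definition coef_n (l : R) (u : option R) : R :=
  if u is Some u then 2 * l ^+ 2 * u ^+ 2 / (l ^+ 2 * u ^+ 2 + 1) else 2.

Definition coef_m (l : R) (u : option R) : R :=
  if u is Some u then 2 * l * u / (l ^+ 2 * u ^+ 2 + 1) else 0.

(* Here the limits at +oo and -oo are pi and -pi, which agree modulo 2 pi. *)
Definition phi (l : R) (u : option R) : R :=
  if u is Some u then 2 * atan (l * u) else pi.

Definition hcoef (G : 'M[R]_n) (lam : 'I_n -> R) (i j : 'I_n) : R :=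
  if i == j then 1
  else 2 * lam i * (lam i * G i j - lam j) / (lam i ^+ 2 - lam j ^+ 2).

Definition principal_submatrix (G : 'M[R]_n) (A : {set 'I_n}) : 'M[R]_#|A| :=
  \matrix_(i, j) G (enum_val i) (enum_val j).

Definition admissible_data (G : 'M[R]_n) (lam s s' : 'I_n -> R) : Prop :=
  [/\ G^T = G /\ (forall i, G i i = 1),
      forall A : {set 'I_n}, (2 <= #|A| <= n.-1)%N ->
        0 < \det (principal_submatrix G A),
      match X with
      | Sph => 0 < \det G
      | Euc => \det G = 0
      | Lob => \det G < 0
      end,
      (forall i, 0 < lam i) /\ (forall i j : 'I_n, (i < j)%N -> lam i < lam j)
    & forall i, (s i = 1 \/ s i = -1) /\ (s' i = 1 \/ s' i = -1)].

(* The vertices of P_u in S^n and Lambda^n. The last conjunct requires them to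
   lie in the space, which for Lambda^n is a condition on the signs. *)
Definition curved_vertices (G : 'M[R]_n) (lam s s' : 'I_n -> R)
    (nv : 'I_n -> V) (m : V) (P : option R -> vertex n -> V) : Prop :=
  exists c : 'I_n -> V,
    let d (i : 'I_n) (u : option R) : V :=
      \sum_j hcoef G lam i j *: c j - coef_n (lam i) u *: nv i
        + coef_m (lam i) u *: m in
    [/\ forall i, (c i <= \matrix_j nv j)%MS,
        forall i j, dotp (c i) (nv j) = (i == j)%:R,
        is_Lob X -> forall i u, dotp (d i u) (d i u) < 0,
        forall u i, P u (inl i) = (s i / vnorm (c i)) *: c i /\
                    P u (inr i) = (s' i / vnorm (d i u)) *: d i u
      & forall u v, in_space (P u v)].

(* [len] is the length of the altitude of the simplex [a] from its i-th vertex;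
   [f] is the foot of this altitude. *)
Definition altitude_length (a : 'I_n -> V) (i : 'I_n) (len : R) : Prop :=
  exists f : V,
    [/\ exists t, point_coord a [set~ i] f t,
        forall j k, j != i -> k != i -> dotp (a i - f) (a j - a k) = 0
      & len = vnorm (a i - f)].

(* The vertices of P_u in E^n; [alt i] and [b i] are the numbers denoted a_i
   and b_i in the construction. *)
Definition euclidean_vertices (G : 'M[R]_n) (lam s s' : 'I_n -> R)
    (nv : 'I_n -> V) (m : V) (P : option R -> vertex n -> V) : Prop :=
  exists (a : 'I_n -> V) (alt b : 'I_n -> R),
    [/\ independent a [set: 'I_n]%SET /\
          (exists p : R, forall i, dotp (a i) m = p),
        forall i j k, j != i -> k != i -> dotp (a j - a k) (nv i) = 0,
        forall i, (s i = 1 /\ forall j, j != i -> 0 < dotp (nv i) (a i - a j))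
               \/ (s i = -1 /\ forall j, j != i -> dotp (nv i) (a i - a j) < 0),
        (forall i, exists len, altitude_length a i len /\ alt i = s i * len) /\
        (forall i, [/\ \sum_j hcoef G lam i j / alt j != 0,
                       b i = (\sum_j hcoef G lam i j / alt j)^-1
                     & s' i = Num.sg (b i)])
      & forall u i, P u (inl i) = a i /\
          P u (inr i) = b i *: (\sum_j (hcoef G lam i j / alt j) *: a j
                                - coef_n (lam i) u *: nv i
                                + coef_m (lam i) u *: m)].

Definition simplest_type (G : 'M[R]_n) (lam s s' : 'I_n -> R)
    (nv : 'I_n -> V) (m : V) (P : option R -> vertex n -> V) : Prop :=
  [/\ admissible_data G lam s s',
      forall i j, dotp (nv i) (nv j) = G i j,
      (forall i, dotp m (nv i) = 0) /\ dotp m m = 1,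
      if is_Euc X then euclidean_vertices G lam s s' nv m P
      else curved_vertices G lam s s' nv m P
    & finite_set [set u | ~ nondegenerate (P u)]].

(* The orientation o of X^n is the one for which m is the interior normal to
   the facet [a_1 ... a_n], whatever the signs s are. (For the opposite
   orientation all oriented dihedral angles change sign. If, for
   s_1 ... s_n = -1, one made m the exterior normal instead, then phi_k would
   enter the formula for the dihedral angles with the opposite sign.) *)
Definition adapted_orientation (m : V) (P : vertex n -> V) (o : R) : Prop :=
  (o = 1 \/ o = -1) /\
  forall x, hull P (facet finset.set0) x -> interior_normal P o finset.set0 x m.

Definition Xset (s s' : 'I_n -> R) (k : 'I_n) : {set 'I_n} :=
  [set i : 'I_n | ((i < k)%N && (s i * s' i == 1))
               || ((k < i)%N && (s i * s' i == -1))].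

End CrossPolytopes.

(* The values at infinity are limits. *)
Lemma coef_bound (R : realType) (l e u : R) : 0 < l -> 0 < e ->
  2 / (l * e) < `|u| ->
  `|coef_n l None - coef_n l (Some u)| < e /\
  `|coef_m l None - coef_m l (Some u)| < e.
Proof.
move=> l0 e0; rewrite ltr_pdivrMr ?mulr_gt0// => hu.
have q0 : 0 < l ^+ 2 * u ^+ 2 + 1.
  by rewrite ltr_pwDr// mulr_ge0// sqr_ge0.
have u0 : 0 < `|u|.
  by rewrite normr_gt0; apply/eqP => uE; move: hu; rewrite uE normr0 mul0r ltNge ler0n.
have uu : u ^+ 2 = `|u| ^+ 2 by rewrite -normrX ger0_norm// sqr_ge0.
have lu0 : 0 < l * `|u| by rewrite mulr_gt0.
split.
- rewrite /coef_n.
  have -> : 2 - 2 * l ^+ 2 * u ^+ 2 / (l ^+ 2 * u ^+ 2 + 1) =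
            2 / (l ^+ 2 * u ^+ 2 + 1)
    by rewrite -[X in X - _](mulfK (lt0r_neq0 q0)) -mulrBl; congr (_ / _); ring.
  rewrite ger0_norm ?divr_ge0 ?ltW// ltr_pdivrMr// uu.
  have : 2 * (l * `|u|) <= l ^+ 2 * `|u| ^+ 2 + 1.
    have := sqr_ge0 (l * `|u| - 1); nra.
  nra.
- rewrite /coef_m sub0r normrN normrM normfV (gtr0_norm q0) ltr_pdivrMr//.
  rewrite !normrM (gtr0_norm l0) normr_nat uu.
  nra.
Qed.

Lemma cvg_coef_n (R : realType) (l : R) : 0 < l ->
  (coef_n l (Some u) @[u --> +oo] --> coef_n l None) /\
  (coef_n l (Some u) @[u --> -oo] --> coef_n l None).
Proof.
move=> l0; split; apply/cvgrPdist_lt => e e0.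
- near=> u; apply: (coef_bound l0 e0 _).1.
  rewrite (lt_le_trans _ (ler_norm _))//.
  by near: u; apply: nbhs_pinfty_gt; rewrite num_real.
- near=> u; apply: (coef_bound l0 e0 _).1.
  rewrite -normrN (lt_le_trans _ (ler_norm _))// ltrNr.
  by near: u; apply: nbhs_ninfty_lt; rewrite num_real.
Unshelve. all: end_near. Qed.

Lemma cvg_coef_m (R : realType) (l : R) : 0 < l ->
  (coef_m l (Some u) @[u --> +oo] --> coef_m l None) /\
  (coef_m l (Some u) @[u --> -oo] --> coef_m l None).
Proof.
move=> l0; split; apply/cvgrPdist_lt => e e0.
- near=> u; apply: (coef_bound l0 e0 _).2.
  rewrite (lt_le_trans _ (ler_norm _))//.
  by near: u; apply: nbhs_pinfty_gt; rewrite num_real.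
- near=> u; apply: (coef_bound l0 e0 _).2.
  rewrite -normrN (lt_le_trans _ (ler_norm _))// ltrNr.
  by near: u; apply: nbhs_ninfty_lt; rewrite num_real.
Unshelve. all: end_near. Qed.

(* Main.v *)
Require Import Defs.
From mathcomp Require Import fingroup perm.
From mathcomp Require Import all_boot all_order all_algebra.
From mathcomp Require Import all_classical all_reals all_analysis.
From mathcomp Require Import ring lra.

Set Implicit Arguments.
Unset Strict Implicit.
Unset Printing Implicit Defensive.

Import Order.TTheory GRing.Theory Num.Theory.

Local Open Scope ring_scope.

(** The dihedral angles at the facets that meet the base facet [a_1 ... a_n] in a
ridge can be read off from the construction: in the plane spanned by n_k and m,
the directions from the ridge opposite to a_k towards a_k and b_k are, up to the
signs s_k and s'_k, those of n_k and of its image under the rotation through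
phi_k towards m. The point of the proof is that every other facet is as good a
base as this one. Replacing the vertex a_k of the base facet by b_k (a flip) gives
again data of the simplest type, with the same lambda and the same u, and only
with another Gram matrix and other signs. As every facet is reached from
[a_1 ... a_n] by flips, the theorem reduces to the base facet and to the
bookkeeping of signs.

To treat the three spaces together, everything is carried to R^(1+n). A point
x of Euclidean space becomes (1,x) and a vector v becomes (0,v); in the other
spaces x stays as it is ([hat]). Hyperplanes are given by covectors, on which
there is the form diag(curvature, 1, ..., 1) with curvature 1, 0 or -1
([cometric]). The normals n_i and m become covectors N_i and M, while the
vertices become non-zero multiples of vectors c_i (for a_i) and d_i (for b_i);
the c_i are dual to the N_i and killed by M. The values N_j(d_i) and M(d_i)
are prescribed functions of lambda, u and of the Gram matrix of the N_i. This
is the structure [flex_frame]; it is established by [curved_base] for the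
sphere and Lobachevsky space and by [euclidean_base] for Euclidean space.

A flip at k rotates the pair (N_k, M) by the angle phi_k, up to a reflection,
and exchanges c_k and d_k. For i different from k, the covector N_i has to be
corrected so as to vanish on the new c_k, and then has to be divided by its
length. That length is the absolute value of
  (lambda_k^2 + lambda_i^2 - 2 g lambda_k lambda_i) / (lambda_k^2 - lambda_i^2),
where g is the Gram entry of N_k and N_i; it does not depend on u. Dividing by
this signed quantity ([stretch_factor]) instead of the length, one finds that
the new frame has the same lambda ([flip_frame]). The numerator is positive
because g lies strictly between -1 and 1 ([gram_bound]), which holds because
the form is positive definite on the covectors vanishing at a point of the
space. So the sign of the stretch factor is that of k - i: a flip at k changes
the signs of the vertices with numbers i > k and exchanges s_k with s'_k.

The unit normals are then multiples of the gradients of N_k and M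
([inner_normalE], [exterior_normalE]). The orientation enters through the
determinant of the basis formed by the vector dual to M and by c_1, ..., c_n;
[det_basis_flip] tells how it changes under a flip. Multiplying all signs ([angle_at], [Xset_sign]) yields the
factor (-1)^|J n X_k| of the theorem. *)

(** * Identities between the coefficients *)

(** The coefficient h_ij of the construction, as a function of lambda_i,
    lambda_j and of the Gram entry g_ij. *)
Definition hentry (R : realType) (li lj g : R) : R :=
  2 * li * (li * g - lj) / (li ^+ 2 - lj ^+ 2).

(** The factor, with a sign, by which a flip at k divides the covector with
    number i; the sign convention is what makes the flip keep lambda instead
    of changing the signs of some of its entries. *)
Definition stretch_factor (R : realType) (lk li g : R) : R :=
  (lk ^+ 2 + li ^+ 2 - 2 * g * lk * li) / (lk ^+ 2 - li ^+ 2).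

Section Scalars.
Variables (R : realType) (u : option R).
Local Notation A l := (coef_n l u).
Local Notation B l := (coef_m l u).

Lemma sq1_neq0 (x : R) : x ^+ 2 + 1 != 0.
Proof. by rewrite lt0r_neq0// ltr_pwDr// sqr_ge0. Qed.

(** [1 - A l] and [B l] are the cosine and the sine of phi. *)
Lemma coef_circle l : B l ^+ 2 = 1 - (1 - A l) ^+ 2.
Proof.
case: u => [v|] /=; last by ring.
by field; apply: sq1_neq0.
Qed.

(** The square of the length of N_i corrected by a multiple of N_k; that it is
    the square of a rational function of lambda is the algebraic coincidence
    behind the whole construction. *)
Lemma stretch_factor_sq (lk li g : R) : lk ^+ 2 - li ^+ 2 != 0 ->
  stretch_factor lk li g ^+ 2 = 1 - 2 * g * hentry lk li g + hentry lk li g ^+ 2.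
Proof. by move=> h; rewrite /stretch_factor /hentry; field. Qed.

(** The five identities below compute the values of the flipped covectors at
    the vectors d_i. The left-hand sides are obtained by expanding the
    definitions; the right-hand sides have the form required of a frame. *)
Lemma flip_height (lk li g : R) : lk ^+ 2 - li ^+ 2 != 0 ->
  B lk * (hentry li lk g - A li * g) - (1 - A lk) * B li =
  stretch_factor lk li g * B li.
Proof.
move=> h; have h' : li ^+ 2 - lk ^+ 2 != 0 by rewrite -opprB oppr_eq0.
rewrite /stretch_factor /hentry; case: u => [v|] /=; last by field; rewrite h h'.
by field; rewrite h h' !sq1_neq0.
Qed.

Lemma flip_pairing_ik (lk li g : R) : lk ^+ 2 - li ^+ 2 != 0 ->
  (1 - A lk) * (hentry li lk g - A li * g) + B lk * B li =
  2 * li * (li * (g - hentry lk li g) - lk * stretch_factor lk li g)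
    / (li ^+ 2 - lk ^+ 2) - A li * (g - hentry lk li g).
Proof.
move=> h; have h' : li ^+ 2 - lk ^+ 2 != 0 by rewrite -opprB oppr_eq0.
rewrite /stretch_factor /hentry; case: u => [v|] /=; last by field; rewrite h h'.
by field; rewrite h h' !sq1_neq0.
Qed.

Lemma flip_pairing_kj (lk li g : R) : lk ^+ 2 - li ^+ 2 != 0 ->
  - (B lk ^+ 2 * g) - (hentry lk li g - A lk * g) * (1 - A lk) =
  2 * lk * (lk * (g - hentry lk li g) - li * stretch_factor lk li g)
    / (lk ^+ 2 - li ^+ 2) - A lk * (g - hentry lk li g).
Proof.
move=> h; rewrite coef_circle /stretch_factor /hentry.
by case: u => [v|] /=; field; rewrite h ?sq1_neq0.
Qed.

Lemma flip_pairing_ii (lk li g : R) : lk ^+ 2 - li ^+ 2 != 0 ->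
  (1 - A li) - B lk * g * (stretch_factor lk li g * B li)
  - (hentry lk li g - A lk * g)
    * ((1 - A lk) * (hentry li lk g - A li * g) + B lk * B li) =
  stretch_factor lk li g ^+ 2 * (1 - A li).
Proof.
move=> h; have h' : li ^+ 2 - lk ^+ 2 != 0 by rewrite -opprB oppr_eq0.
rewrite /stretch_factor /hentry; case: u => [v|] /=; last by field; rewrite h h'.
by field; rewrite h h' !sq1_neq0.
Qed.

Lemma flip_pairing_ij (lk li lj gij gik gjk : R) :
  lk ^+ 2 - li ^+ 2 != 0 -> lk ^+ 2 - lj ^+ 2 != 0 -> li ^+ 2 - lj ^+ 2 != 0 ->
  let gam := gij - gik * hentry lk lj gjk - gjk * hentry lk li gik
             + hentry lk li gik * hentry lk lj gjk in
  (hentry li lj gij - A li * gij)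
  - B lk * gjk * (stretch_factor lk li gik * B li)
  - (hentry lk lj gjk - A lk * gjk)
    * ((1 - A lk) * (hentry li lk gik - A li * gik) + B lk * B li) =
  2 * li * (li * gam - lj * (stretch_factor lk li gik * stretch_factor lk lj gjk))
    / (li ^+ 2 - lj ^+ 2) - A li * gam.
Proof.
move=> h hj hij; have h' : li ^+ 2 - lk ^+ 2 != 0 by rewrite -opprB oppr_eq0.
rewrite /stretch_factor /hentry.
case: u => [v|] /=; last by field; rewrite h h' hj hij.
by field; rewrite h h' hj hij !sq1_neq0.
Qed.
End Scalars.

(** * Homogeneous coordinates for the three spaces *)

Section Pairing.
Variables (R : realType) (X : geometry) (n : nat).
Notation W := 'rV[R]_(1 + n).

Definition curvature : R := match X with Sph => 1 | Euc => 0 | Lob => -1 end.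

(** The vector dual to a covector with respect to [cometric]; for curvature 0
    this form is degenerate, its kernel being the constant functions on R^n. *)
Definition sharp (f : W) : W :=
  f *m diag_mx (\row_i (if i == 0%N :> nat then curvature else 1)).

Definition pairing (x f : W) : R := (x *m f^T) 0 0.

Definition cometric (f g : W) : R := pairing (sharp f) g.

Lemma pairingDl x y f : pairing (x + y) f = pairing x f + pairing y f.
Proof. by rewrite /pairing mulmxDl mxE. Qed.
Lemma pairingZl a x f : pairing (a *: x) f = a * pairing x f.
Proof. by rewrite /pairing -scalemxAl mxE. Qed.
Lemma pairingDr x f g : pairing x (f + g) = pairing x f + pairing x g.
Proof. by rewrite /pairing linearD /= mulmxDr mxE. Qed.
Lemma pairingZr a x f : pairing x (a *: f) = a * pairing x f.
Proof. by rewrite /pairing linearZ /= -scalemxAr mxE. Qed.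
Lemma pairing_suml (I : finType) (x : I -> W) f :
  pairing (\sum_i x i) f = \sum_i pairing (x i) f.
Proof. by rewrite /pairing mulmx_suml summxE. Qed.
Lemma pairingE x f : pairing x f = \sum_i x 0 i * f 0 i.
Proof. by rewrite /pairing mxE; apply: eq_bigr => i _; rewrite mxE. Qed.

Lemma sharpE f i : sharp f 0 i = (if i == 0%N :> nat then curvature else 1) * f 0 i.
Proof. by rewrite /sharp mul_mx_diag !mxE mulrC. Qed.

Lemma cometricC f g : cometric f g = cometric g f.
Proof.
by rewrite /cometric !pairingE; apply: eq_bigr => i _; rewrite !sharpE; ring.
Qed.
Lemma cometricDl f g h : cometric (f + g) h = cometric f h + cometric g h.
Proof. by rewrite /cometric /sharp mulmxDl pairingDl. Qed.
Lemma cometricZl a f g : cometric (a *: f) g = a * cometric f g.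
Proof. by rewrite /cometric /sharp -scalemxAl pairingZl. Qed.
Lemma cometricDr f g h : cometric f (g + h) = cometric f g + cometric f h.
Proof. exact: pairingDr. Qed.
Lemma cometricZr a f g : cometric f (a *: g) = a * cometric f g.
Proof. exact: pairingZr. Qed.

Definition bilinE := (pairingDl, pairingDr, pairingZl, pairingZr,
  cometricDl, cometricDr, cometricZl, cometricZr).
End Pairing.
Arguments sharp {R} X {n} f.
Arguments pairing {R n} x f.
Arguments cometric {R} X {n} f g.


Section Homogeneous.
Variables (R : realType) (X : geometry) (n : nat).
Notation V := (ambient R X n).
Notation W := 'rV[R]_(1 + n).

Lemma dotpDl (x y z : V) : dotp (x + y) z = dotp x z + dotp y z.
Proof. by rewrite /dotp -big_split /=; apply: eq_bigr => i _; rewrite mxE; ring. Qed.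
Lemma dotpZl a (x y : V) : dotp (a *: x) y = a * dotp x y.
Proof. by rewrite /dotp mulr_sumr; apply: eq_bigr => i _; rewrite mxE; ring. Qed.
Lemma dotpC (x y : V) : dotp x y = dotp y x.
Proof. by apply: eq_bigr => i _; rewrite [x 0 i * _]mulrC. Qed.
Lemma dotpZr a (x y : V) : dotp y (a *: x) = a * dotp y x.
Proof. by rewrite dotpC dotpZl dotpC. Qed.
Lemma dotpBl (x y z : V) : dotp (x - y) z = dotp x z - dotp y z.
Proof. by rewrite -scaleN1r dotpDl dotpZl mulN1r. Qed.
Lemma dotpBr (x y z : V) : dotp z (x - y) = dotp z x - dotp z y.
Proof. by rewrite dotpC dotpBl !(dotpC z). Qed.
Lemma dotp0l (z : V) : dotp 0 z = 0.
Proof. by rewrite -(scale0r 0) dotpZl mul0r. Qed.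
Lemma dotp_suml (T : finType) (x : T -> V) y : dotp (\sum_i x i) y = \sum_i dotp (x i) y.
Proof.
by apply: (big_morph (fun z => dotp z y)) => [a b|]; rewrite ?dotpDl ?dotp0l.
Qed.

(** [hat 1] is meant for points and [hat 0] for tangent vectors; they differ in
    Euclidean space only, so that affine and linear (in)dependence become the
    same notion. *)
Definition hat (e : R) : V -> W :=
  match X return 'rV[R]_(vdim X n) -> W with
  | Euc => fun x => row_mx (const_mx e) x
  | _ => fun x => x
  end.

(** The gradient of a covector: its [sharp], seen as a tangent vector. *)
Definition grad : W -> V :=
  match X return W -> 'rV[R]_(vdim X n) with
  | Euc => fun f => rsubmx f
  | Sph => sharp Sph
  | Lob => sharp Lob
  end.

(** A covector with gradient [v]; in Euclidean space [a] is its constant term. *)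
Definition flat (a : R) : V -> W :=
  match X return 'rV[R]_(vdim X n) -> W with
  | Euc => fun v => row_mx (const_mx a) v
  | Sph => sharp Sph
  | Lob => sharp Lob
  end.
End Homogeneous.
Arguments hat {R X n}.
Arguments grad {R X n}.
Arguments flat {R X n}.

Section HomTheory.
Variables (R : realType) (n : nat).
Notation W := 'rV[R]_(1 + n).

Lemma sharpK X (f : W) : ~~ is_Euc X -> sharp X (sharp X f) = f.
Proof.
move=> hX; apply/rowP => i; rewrite !sharpE /curvature.
by case: X hX => //; case: eqP => _ _; ring.
Qed.

Variable X : geometry.
Notation V := (ambient R X n).

Lemma hatD e e' (x y : V) : hat e x + hat e' y = hat (e + e') (x + y).
Proof.
case: X x y => //= x y; rewrite add_row_mx; congr row_mx.
by apply/matrixP => i j; rewrite !mxE.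
Qed.
Lemma hatZ a e (x : V) : a *: hat e x = hat (a * e) (a *: x).
Proof.
case: X x => //= x; rewrite scale_row_mx; congr row_mx.
by apply/matrixP => i j; rewrite !mxE.
Qed.
Lemma hat00 : hat 0 (0 : V) = 0.
Proof. by rewrite -(scale0r (hat 0 (0:V))) hatZ mul0r scaler0. Qed.
Lemma hat_sum (I : finType) (t : I -> R) (x : I -> V) :
  \sum_i t i *: hat 1 (x i) = hat (\sum_i t i) (\sum_i t i *: x i).
Proof.
elim/big_rec3: _ => [|i z y1 y2 _ ->]; first by rewrite hat00.
by rewrite hatZ mulr1 hatD.
Qed.
Lemma hat0_sum (I : finType) (t : I -> R) (x : I -> V) :
  hat 0 (\sum_i t i *: x i) = \sum_i t i *: hat 0 (x i).
Proof.
elim/big_rec2: _ => [|i z y1 _ <-]; first by rewrite hat00.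
by rewrite hatZ mulr0 hatD addr0.
Qed.
Lemma hat_inj e e' (x y : V) : hat e x = hat e' y <-> x = y /\ (is_Euc X -> e = e').
Proof.
case: X x y => /= x y; try by split => [->|[-> _]].
split=> [/eq_row_mx [/matrixP/(_ 0 0)]|[-> ->//]].
by rewrite !mxE => -> ->.
Qed.

Lemma hat_grad f : hat 0 (grad f : V) = sharp X f.
Proof.
rewrite /grad; case: X => //=.
rewrite -[RHS]hsubmxK; congr row_mx; apply/rowP => i; rewrite [LHS]mxE [RHS]mxE sharpE.
  by rewrite ord1 /= mul0r.
by rewrite /= mul1r.
Qed.

Lemma pairing_hat0 (v : V) f : pairing (hat 0 v) f = dotp v (grad f).
Proof.
rewrite pairingE /dotp /grad; case: X v => /= v.
- apply: eq_bigr => i _; rewrite sharpE /curvature; case: ifP; rewrite !mul1r //.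
- rewrite big_split_ord /= big_ord1 row_mxEl mxE mul0r add0r.
  by apply: eq_bigr => i _; rewrite row_mxEr mul1r !mxE.
- apply: eq_bigr => i _; rewrite sharpE /curvature; case: ifP => _; ring.
Qed.

Lemma cometric_grad f g : cometric X f g = dotp (grad f : V) (grad g).
Proof. by rewrite /cometric -hat_grad pairing_hat0. Qed.

Lemma grad_flat a (v : V) : grad (flat a v) = v.
Proof.
rewrite /grad /flat; case: X v => /= v; rewrite ?sharpK ?row_mxKr //.
Qed.

Lemma sum_sqr_gt0 k (z : 'rV[R]_k) : z != 0 -> 0 < \sum_i z 0 i ^+ 2.
Proof.
move=> z0; rewrite lt_def sumr_ge0 => [|i _]; last exact: sqr_ge0.
rewrite andbT; apply: contra z0 => /eqP z0; apply/eqP/rowP => i.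
move/psumr_eq0P: z0 => /(_ (fun i _ => sqr_ge0 _)) /(_ i isT) /eqP.
by rewrite sqrf_eq0 mxE => /eqP.
Qed.

(** In Lobachevsky space the tangent space at [x] is the orthogonal complement
    of a time-like vector. The identity in the proof is the reversed
    Cauchy-Schwarz inequality written as a sum of squares. *)
Lemma tangent_pos (x r : V) : in_space x -> tangent x r -> r != 0 -> 0 < dotp r r.
Proof.
rewrite /tangent; case: X x r => /= x r.
- move=> _ _ r0; rewrite (_ : dotp r r = \sum_i r 0 i ^+ 2) ?sum_sqr_gt0//.
  by apply: eq_bigr => i _; rewrite mul1r expr2.
- move=> _ _ r0; rewrite (_ : dotp r r = \sum_i r 0 i ^+ 2) ?sum_sqr_gt0//.
  by apply: eq_bigr => i _; rewrite mul1r expr2.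
move=> [xx x0] [//|xr] rn0.
have dE (y z : 'rV[R]_n.+1) : dotp (X := Lob) y z =
    - (y 0 0 * z 0 0) + \sum_(i < n) y 0 (lift ord0 i) * z 0 (lift ord0 i).
  rewrite /dotp /= big_ord_recl /= mulN1r; congr (_ + _).
  by apply: eq_bigr => i _; rewrite mul1r.
have E : x 0 0 ^+ 2 * dotp (X := Lob) r r = r 0 0 ^+ 2 +
    \sum_(i < n) (x 0 0 * r 0 (lift ord0 i) - r 0 0 * x 0 (lift ord0 i)) ^+ 2.
  have sxx : \sum_(i < n) x 0 (lift ord0 i) * x 0 (lift ord0 i) = x 0 0 * x 0 0 - 1.
    by move: xx; rewrite dE; lra.
  have sxr : \sum_(i < n) x 0 (lift ord0 i) * r 0 (lift ord0 i) = x 0 0 * r 0 0.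
    by move: xr; rewrite dE; lra.
  rewrite (_ : \sum_(i < n) _ =
      x 0 0 ^+ 2 * (\sum_(i < n) r 0 (lift ord0 i) * r 0 (lift ord0 i))
    + r 0 0 ^+ 2 * (\sum_(i < n) x 0 (lift ord0 i) * x 0 (lift ord0 i))
    - 2 * x 0 0 * r 0 0 * (\sum_(i < n) x 0 (lift ord0 i) * r 0 (lift ord0 i))).
    by rewrite sxx sxr dE; ring.
  rewrite !mulr_sumr -big_split /= -sumrB.
  by apply: eq_bigr => i _; ring.
have x00 : 0 < x 0 0 by exact: x0.
rewrite -(pmulr_rgt0 _ (exprn_gt0 2 x00)) E.
have [r00|r00] := eqVneq (r 0 0) 0; last first.
  rewrite ltr_pwDl ?exprn_even_gt0//.
  by apply: sumr_ge0 => i _; rewrite sqr_ge0.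
rewrite r00 expr0n add0r; under eq_bigr do rewrite mul0r subr0 exprMn.
rewrite -mulr_sumr mulr_gt0 ?exprn_gt0//.
have := @sum_sqr_gt0 _ (\row_i r 0 (lift ord0 i)); under eq_bigr do rewrite mxE; apply.
apply: contra rn0 => /eqP/rowP z; apply/eqP/rowP => i.
by case: (unliftP ord0 i) => [j|] ->; [have := z j; rewrite !mxE | rewrite mxE].
Qed.

Lemma pairing_hat1_tangent (x : V) f : pairing (hat 1 x) f = 0 -> tangent x (grad f).
Proof.
rewrite /tangent; case: (boolP (is_Euc X)) => [eX _|hX pf]; [by left|right].
rewrite -pairing_hat0 -[RHS]pf; congr (pairing _ _).
by apply/hat_inj; split => // e; rewrite e in hX.
Qed.

(** A covector that vanishes at a point of the space is determined by its
    gradient, which is tangent at this point. *)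
Lemma cometric_pos f : f != 0 ->
  X = Sph \/ (exists2 x : V, in_space x & pairing (hat 1 x) f = 0) ->
  0 < cometric X f f.
Proof.
move=> f0 [XS|[x xs fx]].
  rewrite /cometric pairingE (_ : \sum_i _ = \sum_i f 0 i ^+ 2) ?sum_sqr_gt0//.
  by apply: eq_bigr => i _; rewrite sharpE /curvature XS if_same mul1r expr2.
rewrite cometric_grad; apply: (tangent_pos xs); first exact: pairing_hat1_tangent.
apply: contra f0 => /eqP g0; apply/eqP.
move: fx g0; rewrite /grad; case: X x xs => /= x xs fx g0.
- by rewrite -[f](@sharpK Sph)// g0 /sharp mul0mx.
- move: fx; rewrite pairingE -[f]hsubmxK g0 big_split_ord /= big_ord1.
  rewrite !row_mxEl mxE mul1r big1 ?addr0 => [f00|i _]; last first.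
    by rewrite !row_mxEr !mxE mulr0.
  rewrite (_ : lsubmx f = 0) ?row_mx0//.
  by apply/matrixP => i j; rewrite !ord1 f00 !mxE.
- by rewrite -[f](@sharpK Lob)// g0 /sharp mul0mx.
Qed.
End HomTheory.

(** * Frames and flips *)

Section Frames.
Variables (R : realType) (X : geometry) (n : nat) (lam : 'I_n -> R) (u : option R).
Notation W := 'rV[R]_(1 + n).
Notation A i := (coef_n (lam i) u).
Notation B i := (coef_m (lam i) u).

(** The data of the construction seen from one facet: the vertices of the facet
    are proportional to the [c i], the opposite ones to the [d i], and [N i],
    [M] are the covectors with gradients n_i and m. *)
Record flex_frame (c d N : 'I_n -> W) (M : W) : Prop := FlexFrame {
  ff_cN : forall i j, pairing (c i) (N j) = (i == j)%:R;
  ff_cM : forall i, pairing (c i) M = 0;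
  ff_NN : forall i, cometric X (N i) (N i) = 1;
  ff_NM : forall i, cometric X (N i) M = 0;
  ff_MM : cometric X M M = 1;
  ff_dN : forall i, pairing (d i) (N i) = 1 - A i;
  ff_dNj : forall i j, i != j -> pairing (d i) (N j) =
    hentry (lam i) (lam j) (cometric X (N i) (N j)) - A i * cometric X (N i) (N j);
  ff_dM : forall i, pairing (d i) M = B i
}.

Hypothesis lam_sq_inj : forall i j, i != j -> lam i ^+ 2 - lam j ^+ 2 != 0.

(** In this section the vertex number [k] of the facet is replaced by the opposite
    one. *)
Section Flip.
Variables (c d N : 'I_n -> W) (M : W) (k : 'I_n).

Definition stretch i := stretch_factor (lam k) (lam i) (cometric X (N k) (N i)).

(** [flipNk] and [flipM] are the images of [N k] and [M] under the rotation by
    phi_k in their plane, the second one with the opposite sign. *)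
Definition flipNk := (1 - A k) *: N k + B k *: M.
Definition flipM := B k *: N k + (- (1 - A k)) *: M.
(** [N i] is corrected so as to be orthogonal to [flipM] and to vanish at the new
    vertex [d k]. *)
Definition flipN i :=
  let g := cometric X (N k) (N i) in
  if i == k then flipNk else
  (stretch i)^-1 *: (N i + (- (B k * g)) *: flipM
                   + (- (hentry (lam k) (lam i) g - A k * g)) *: flipNk).
Definition flipc i := if i == k then d k else stretch i *: c i.
Definition flipd i := if i == k then c k else (stretch i)^-1 *: d i.

Hypothesis F : flex_frame c d N M.
Hypothesis stretch_neq0 : forall i, i != k -> stretch i != 0.

(** Flips preserve the simplest type, with the same [lam] and [u]. After the
    Gram matrix of the new covectors has been computed, the axioms follow from
    the identities of the first part. *)
Lemma flip_frame : flex_frame flipc flipd flipN flipM.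
Proof.
have [cN cM NN NM MM dN dNj dM] := F.
have MN i : cometric X M (N i) = 0 by rewrite cometricC.
have ckN i : i != k -> pairing (c k) (N i) = 0 by move=> ik; rewrite cN eq_sym (negPf ik).
have cNk i : i != k -> pairing (c i) (N k) = 0 by move=> ik; rewrite cN (negPf ik).
have cNN i : pairing (c i) (N i) = 1 by rewrite cN eqxx.
have E := coef_circle u (lam k).
have gC i : cometric X (N i) (N k) = cometric X (N k) (N i) by rewrite cometricC.
have ne i : i != k -> k != i by rewrite eq_sym.
have ghik i : i != k -> pairing (d i) (N k) =
    hentry (lam i) (lam k) (cometric X (N k) (N i)) - A i * cometric X (N k) (N i).
  by move=> ik; rewrite dNj// gC.
have ghki i : i != k -> pairing (d k) (N i) =
    hentry (lam k) (lam i) (cometric X (N k) (N i)) - A k * cometric X (N k) (N i).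
  by move=> ik; rewrite dNj// ne.
have gk i : i != k -> cometric X flipNk (flipN i) =
    (cometric X (N k) (N i) - hentry (lam k) (lam i) (cometric X (N k) (N i))) / stretch i.
  move=> ik; rewrite /flipN (negPf ik) /flipNk /flipM !bilinE !NN !NM !MM !MN.
  set g := cometric X _ _; set h := hentry _ _ _.
  transitivity ((stretch i)^-1 *
    ((1 - A k) * g - (h - A k * g) * ((1 - A k) ^+ 2 + B k ^+ 2))); first by ring.
  by rewrite E; ring.
have gij i j : i != k -> j != k -> cometric X (flipN i) (flipN j) =
    (cometric X (N i) (N j)
     - cometric X (N k) (N i) * hentry (lam k) (lam j) (cometric X (N k) (N j))
     - cometric X (N k) (N j) * hentry (lam k) (lam i) (cometric X (N k) (N i))
     + hentry (lam k) (lam i) (cometric X (N k) (N i))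
       * hentry (lam k) (lam j) (cometric X (N k) (N j)))
     / (stretch i * stretch j).
  move=> ik jk; rewrite /flipN (negPf ik) (negPf jk) /flipNk /flipM !bilinE !NN !NM !MM !MN !gC.
  set gi := cometric X (N k) (N i); set gj := cometric X (N k) (N j).
  set hi := hentry _ _ gi; set hj := hentry _ _ gj; set g := cometric X _ _.
  rewrite (invfM (stretch i)); set ri := (stretch i)^-1; set rj := (stretch j)^-1.
  transitivity (ri * rj * (g - gi * (hj - A k * gj) * (1 - A k)
    - gj * (hi - A k * gi) * (1 - A k) - 2 * B k ^+ 2 * gi * gj
    + (B k ^+ 2 * gi * gj + (hi - A k * gi) * (hj - A k * gj))
      * ((1 - A k) ^+ 2 + B k ^+ 2))).
    by ring.
  by rewrite E; ring.
split.
- move=> i j; rewrite /flipc /flipN.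
  have [eik|ik] := eqVneq i k; have [ejk|jk] := eqVneq j k;
    rewrite ?eik ?ejk /flipNk /flipM !bilinE.
  + rewrite dN dM ?eqxx mulr1n.
    by transitivity ((1 - A k) ^+ 2 + B k ^+ 2); [ring | rewrite E; ring].
  + rewrite dN dM ghki// eq_sym (negPf jk) mulr0n.
    set g := cometric X _ _; set h := hentry _ _ _; set r := (stretch j)^-1.
    transitivity (r * (h - A k * g) * (1 - ((1 - A k) ^+ 2 + B k ^+ 2))); first by ring.
    by rewrite E; ring.
  + by rewrite cNk// cM (negPf ik) mulr0n; ring.
  + rewrite cNk// cM cN; have [<-|_] := eqVneq i j; rewrite ?mulr0n ?mulr1n; last by ring.
    by have := stretch_neq0 ik; set r := stretch i => r0; field.
- move=> i; rewrite /flipc /flipM; have [eik|ik] := eqVneq i k; rewrite ?eik; rewrite !bilinE.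
    by rewrite dN dM; ring.
  by rewrite cNk// cM; ring.
- move=> i; have [eik|ik] := eqVneq i k; rewrite ?eik.
    rewrite /flipN eqxx /flipNk !bilinE !NN !NM !MM !MN.
    by transitivity ((1 - A k) ^+ 2 + B k ^+ 2); [ring | rewrite E; ring].
  rewrite gij// NN.
  have := stretch_factor_sq (cometric X (N k) (N i)) (lam_sq_inj (ne _ ik)).
  rewrite -/(stretch i); set g := cometric X _ _; set h := hentry _ _ _ => sq.
  rewrite -[X in _ / X]expr2 sq (_ : _ - _ + _ = 1 - 2 * g * h + h ^+ 2); last by ring.
  by rewrite -sq divff// expf_neq0// stretch_neq0.
- move=> i; rewrite /flipN; have [eik|ik] := eqVneq i k; rewrite ?eik;
    rewrite /flipNk /flipM !bilinE !NN !NM !MM !MN ?gC; first by ring.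
  set g := cometric X _ _; set h := hentry _ _ _; set r := (stretch i)^-1.
  by transitivity (r * B k * g * (1 - ((1 - A k) ^+ 2 + B k ^+ 2))); [ring | rewrite E; ring].
- rewrite /flipM !bilinE !NN !NM !MM !MN.
  by transitivity ((1 - A k) ^+ 2 + B k ^+ 2); [ring | rewrite E; ring].
- move=> i; rewrite /flipN /flipd; have [eik|ik] := eqVneq i k; rewrite ?eik.
    by rewrite /flipNk !bilinE cNN cM; ring.
  rewrite /flipNk /flipM !bilinE dN ghik// dM.
  have := flip_pairing_ii u (cometric X (N k) (N i)) (lam_sq_inj (ne _ ik)).
  have := flip_height u (cometric X (N k) (N i)) (lam_sq_inj (ne _ ik)).
  have := stretch_neq0 ik.
  rewrite -/(stretch i); set g := cometric X _ _; set h := hentry (lam k) _ _.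
  set h' := hentry (lam i) _ _; set r := stretch i => r0 e7 e6.
  transitivity ((r ^- 2) * (1 - A i
    - B k * g * (B k * (h' - A i * g) - (1 - A k) * B i)
    - (h - A k * g) * ((1 - A k) * (h' - A i * g) + B k * B i))).
    by field.
  by rewrite e7 e6; field.
- move=> i j ij; have [eik|ik] := eqVneq i k; have [ejk|jk] := eqVneq j k.
  + by rewrite eik ejk eqxx in ij.
  + rewrite eik in ij *; have -> : flipN k = flipNk by rewrite /flipN eqxx.
    rewrite gk// /flipd /flipN eqxx (negPf jk) /flipNk /flipM !bilinE cNN cM ckN//.
    have := flip_pairing_kj u (cometric X (N k) (N j)) (lam_sq_inj ij).
    have := stretch_neq0 jk; have := lam_sq_inj ij.
    rewrite -/(stretch j); set g := cometric X _ _; set h := hentry _ _ g; set r := stretch j.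
    move=> l0 r0 e.
    transitivity (r^-1 * (- (B k ^+ 2 * g) - (h - A k * g) * (1 - A k))); first by ring.
    by rewrite e /hentry; field; rewrite r0 l0.
  + rewrite ejk in ij *; have -> : flipN k = flipNk by rewrite /flipN eqxx.
    rewrite [cometric X _ flipNk]cometricC gk// /flipd (negPf ik) /flipNk !bilinE ghik// dM.
    have := flip_pairing_ik u (cometric X (N k) (N i)) (lam_sq_inj (ne _ ik)).
    have := stretch_neq0 ik; have := lam_sq_inj ij.
    rewrite -/(stretch i); set g := cometric X _ _; set h := hentry (lam k) _ g; set r := stretch i.
    set h' := hentry _ _ g; move=> l0 r0 e.
    transitivity (r^-1 * ((1 - A k) * (h' - A i * g) + B k * B i)); first by ring.
    by rewrite e /hentry; field; rewrite r0 l0.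
  + rewrite gij// /flipd /flipN (negPf ik) (negPf jk) /flipNk /flipM !bilinE dNj// ghik// dM.
    have := flip_pairing_ij u (cometric X (N i) (N j))
      (cometric X (N k) (N i)) (cometric X (N k) (N j))
      (lam_sq_inj (ne _ ik)) (lam_sq_inj (ne _ jk)) (lam_sq_inj ij).
    have := flip_height u (cometric X (N k) (N i)) (lam_sq_inj (ne _ ik)).
    have := stretch_neq0 ik; have := stretch_neq0 jk; have := lam_sq_inj ij.
    rewrite -/(stretch i) -/(stretch j).
    set gi := cometric X (N k) (N i); set gj := cometric X (N k) (N j); set g := cometric X _ _.
    set hij := hentry (lam i) (lam j) g; set hik := hentry (lam i) (lam k) _.
    set hki := hentry (lam k) (lam i) _; set hkj := hentry (lam k) (lam j) _.
    set ri := stretch i; set rj := stretch j => l0 rj0 ri0 e7 /=.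
    set gam := g - _ - _ + _; rewrite -e7 => e.
    transitivity ((ri * rj)^-1 * (hij - A i * g
      - B k * gj * (B k * (hik - A i * gi) - (1 - A k) * B i)
      - (hkj - A k * gj) * ((1 - A k) * (hik - A i * gi) + B k * B i))).
      by field; rewrite ri0 rj0.
    by rewrite e /hentry; field; rewrite ri0 rj0 l0.
- move=> i; rewrite /flipd /flipM; have [eik|ik] := eqVneq i k; rewrite ?eik; rewrite !bilinE.
    by rewrite cNN cM; ring.
  rewrite ghik// dM.
  have := flip_height u (cometric X (N k) (N i)) (lam_sq_inj (ne _ ik)).
  have := stretch_neq0 ik.
  rewrite -/(stretch i); set g := cometric X _ _; set h := hentry _ _ _.
  set r := stretch i => r0 e7.
  by transitivity (r^-1 * (B k * (h - A i * g) - (1 - A k) * B i)); [ring | rewrite e7; field].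
Qed.
End Flip.
End Frames.

(** * The determinant of a frame *)

(** Sylvester's determinant identity. *)
Lemma det_1DmulC (R : comNzRingType) m p (U : 'M[R]_(m, p)) (V : 'M[R]_(p, m)) :
  \det (1%:M + U *m V) = \det (1%:M + V *m U).
Proof.
have e1 : block_mx (1%:M + U *m V) (- U) 0 1%:M *m block_mx 1%:M 0 V 1%:M
    = block_mx 1%:M (- U) V 1%:M.
  by rewrite mulmx_block ?(mulmx1, mulmx0, mul0mx, mul1mx) ?add0r mulNmx addrK.
have e2 : block_mx 1%:M 0 V 1%:M *m block_mx 1%:M (- U) 0 (1%:M + V *m U)
    = block_mx 1%:M (- U) V 1%:M.
  by rewrite mulmx_block ?(mulmx1, mulmx0, mul0mx, mul1mx) ?addr0 mulmxN addrCA addNr addr0.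
have := congr1 determinant (etrans e1 (esym e2)).
by rewrite !det_mulmx !det_ublock !det_lblock !det1 !mulr1 !mul1r.
Qed.

Lemma det_mx2 (R : comNzRingType) (A : 'M[R]_2) :
  \det A = A 0 0 * A 1 1 - A 0 1 * A 1 0.
Proof.
rewrite (expand_det_row _ 0) !big_ord_recl big_ord0 addr0 /cofactor !det_mx11 !mxE /=.
rewrite expr0 mul1r expr1 mulN1r mulrN.
by congr (_ * A _ _ - A _ _ * A _ _); apply: val_inj.
Qed.

(** Such a matrix is a diagonal matrix times the identity perturbed by a matrix
    of rank at most 2, so its determinant reduces to one of size 2. *)
Lemma det_two_rows (R : comNzRingType) m (T : 'M[R]_m) (p q : 'I_m) : p != q ->
  (forall i j, i != p -> i != q -> i != j -> T i j = 0) ->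
  \det T = (T p p * T q q - T p q * T q p) * \prod_(i | (i != p) && (i != q)) T i i.
Proof.
move=> pq Tdiag.
pose pos (a : 'I_2) := if a == 0 then p else q.
pose U : 'M[R]_(m, 2) := \matrix_(i, a) (i == pos a)%:R.
pose V : 'M[R]_(2, m) := \matrix_(a, j) (T (pos a) j - (pos a == j)%:R).
pose D : 'rV[R]_m := \row_i if (i != p) && (i != q) then T i i else 1.
have eT : T = diag_mx D *m (1%:M + U *m V).
  apply/matrixP => i j; rewrite mul_diag_mx !mxE !big_ord_recl big_ord0 addr0 !mxE /pos /=.
  have [->|ip] := eqVneq i p; first by rewrite (negPf pq) /=; ring.
  have [->|iq] := eqVneq i q; first by rewrite /=; ring.
  have [<-|ij] := eqVneq i j; first by rewrite /=; ring.
  by rewrite Tdiag//=; ring.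
rewrite [in LHS]eT det_mulmx det_diag det_1DmulC mulrC; congr (_ * _).
  have VU a b : (V *m U) a b = V a (pos b).
    rewrite mxE (bigD1 (pos b)) //= big1 => [|i ib]; last by rewrite [U _ _]mxE (negPf ib) mulr0.
    by rewrite [U _ _]mxE eqxx mulr1 addr0.
  rewrite det_mx2 ![(1%:M + _) _ _]mxE !VU !mxE /pos /= !eqxx (negPf pq) eq_sym (negPf pq) /=.
  ring.
rewrite [RHS]big_mkcond; apply: eq_bigr => i _; rewrite mxE.
by [].
Qed.

Section Basis.
Variables (R : realType) (X : geometry) (n : nat) (lam : 'I_n -> R) (u : option R).
Notation W := 'rV[R]_(1 + n).
Notation A i := (coef_n (lam i) u).
Notation B i := (coef_m (lam i) u).

(** [sharp X M] completes the vectors [c i] to a basis whose dual basis is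
    formed by [M] and the [N i]. *)
Definition basis_mx (c : 'I_n -> W) (M : W) : 'M[R]_(1 + n) :=
  col_mx (sharp X M) (\matrix_i c i).
Definition dual_mx (N : 'I_n -> W) (M : W) : 'M[R]_(1 + n) :=
  col_mx M (\matrix_i N i).

Lemma mul_trE (p q : nat) (S : 'M[R]_(p, 1 + n)) (T : 'M[R]_(q, 1 + n)) i j :
  (S *m T^T) i j = pairing (row i S) (row j T).
Proof. by rewrite pairingE mxE; apply: eq_bigr => l _; rewrite !mxE. Qed.

Variables (c d N : 'I_n -> W) (M : W).
Hypothesis F : flex_frame X lam u c d N M.

Lemma sharp_dual i : pairing (sharp X M) (N i) = 0.
Proof. by rewrite -/(cometric X M _) cometricC (ff_NM F). Qed.

Lemma basis_dual : basis_mx c M *m (dual_mx N M)^T = 1%:M.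
Proof.
rewrite /basis_mx /dual_mx tr_col_mx mul_col_row scalar_mx_block.
congr block_mx; apply/matrixP => i j; rewrite mul_trE ?ord1 ?rowK ?row_id ?mxE.
- exact: (ff_MM F).
- exact: sharp_dual.
- exact: (ff_cM F).
- exact: (ff_cN F).
Qed.

Lemma frame_expand x : x = pairing x M *: sharp X M + \sum_i pairing x (N i) *: c i.
Proof.
rewrite -[LHS]mulmx1 -(mulmx1C basis_dual) mulmxA.
rewrite {1}/dual_mx tr_col_mx mul_mx_row mul_row_col; congr (_ + _).
  by rewrite [_ *m _^T]mx11_scalar mul_scalar_mx.
rewrite mulmx_sum_row; apply: eq_bigr => i _; rewrite rowK; congr (_ *: _).
by rewrite mul_trE row_id rowK.
Qed.

(** The minus sign is the determinant of the transformation of the plane of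
    [N k] and [M], a rotation followed by a reflection. *)
Lemma det_basis_flip (k : 'I_n) :
  \det (basis_mx (flipc X lam c d N k) (flipM lam u N M k)) =
  - (\prod_(i | i != k) stretch X lam N k i) * \det (basis_mx c M).
Proof.
set E' := basis_mx _ _; set E := basis_mx c M.
have -> : E' = (E' *m (dual_mx N M)^T) *m E.
  by rewrite -mulmxA (mulmx1C basis_dual) mulmx1.
rewrite det_mulmx; congr (_ * _).
have EE : E' *m (dual_mx N M)^T = block_mx
    (pairing (sharp X (flipM lam u N M k)) M)%:M
    (\matrix_(i, j) pairing (sharp X (flipM lam u N M k)) (N j))
    (\matrix_(i, j) pairing (flipc X lam c d N k i) M)
    (\matrix_(i, j) pairing (flipc X lam c d N k i) (N j)).
  rewrite /E' /basis_mx /dual_mx tr_col_mx mul_col_row.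
  congr block_mx; apply/matrixP => i j; rewrite mul_trE ?ord1 ?rowK ?row_id !mxE ?eqxx//.
rewrite EE (@det_two_rows _ _ _ (lshift n 0) (rshift 1 k)).
- rewrite block_mxEul block_mxEdr block_mxEur block_mxEdl !mxE eqxx mulr1n.
  rewrite -!/(cometric X _ _) /flipM /flipc eqxx !bilinE (ff_MM F) (ff_NN F) (ff_NM F).
  rewrite (cometricC _ M) (ff_NM F) (ff_dN F) (ff_dM F).
  rewrite big_split_ord /= big_ord1_cond eqxx /= mul1r.
  rewrite (eq_bigl (fun i => i != k)); last first.
    by move=> i; rewrite /= (inj_eq (@rshift_inj _ _)).
  rewrite -[RHS]mulN1r; congr (_ * _); last first.
    by apply: eq_bigr => i ik; rewrite block_mxEdr mxE (negPf ik) pairingZl (ff_cN F) eqxx mulr1.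
  have := coef_circle u (lam k) => e.
  transitivity (- ((1 - A k) ^+ 2 + B k ^+ 2)); first by ring.
  by rewrite e; ring.
- by rewrite -val_eqE.
move=> a b; case: (split_ordP a) => i ->; rewrite ?ord1 ?eqxx// => _.
rewrite (inj_eq (@rshift_inj _ _)) => ik; case: (split_ordP b) => j -> => [_|].
  by rewrite block_mxEdl mxE /flipc (negPf ik) pairingZl (ff_cM F) mulr0.
rewrite (inj_eq (@rshift_inj _ _)) => ij.
by rewrite block_mxEdr mxE /flipc (negPf ik) pairingZl (ff_cN F) (negPf ij) mulr0.
Qed.
End Basis.

(** * Normals to facets and ridges *)

Lemma facet_vertex_inj n (J : {set 'I_n}) : injective (facet_vertex J).
Proof. by rewrite /facet_vertex => i j; do 2!case: ifP => _; case. Qed.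

Lemma mem_facet n (J : {set 'I_n}) v :
  reflect (exists i, v = facet_vertex J i) (v \in facet J).
Proof.
apply: (iffP idP) => [|[i ->]].
  rewrite inE; case: v => i; rewrite ?inE => iJ; exists i.
    by rewrite /facet_vertex (negPf iJ).
  by rewrite /facet_vertex iJ.
by rewrite inE /facet_vertex; case: ifP => iJ //; rewrite inE iJ.
Qed.

Lemma facet_vertexP n (J : {set 'I_n}) i : facet_vertex J i \in facet J.
Proof. by apply/mem_facet; exists i. Qed.

Lemma sum_facet (R : nzRingType) (W : lmodType R) n (J : {set 'I_n})
    (t : vertex n -> R) (y : vertex n -> W) :
  (forall v, v \notin facet J -> t v = 0) ->
  \sum_v t v *: y v = \sum_i t (facet_vertex J i) *: y (facet_vertex J i).
Proof.
move=> t0; rewrite (bigID (mem (facet J))) /= addrC.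
rewrite big1 ?add0r => [|v vJ]; last by rewrite t0// scale0r.
transitivity (\sum_(v in [set facet_vertex J i | i in [set: 'I_n]%SET]%SET) t v *: y v).
  apply: eq_bigl => v; apply/mem_facet/imsetP => [[i ->]|[i _ ->]]; by exists i; rewrite ?inE.
rewrite big_imset => [|i j _ _]; last exact: facet_vertex_inj.
by apply: eq_bigl => i; rewrite inE.
Qed.

(** Used to complete a point of a facet to a positively oriented frame: the first
    row of the matrix is formed by the coordinates of the point, the others by
    those of tangent vectors pointing towards the vertices [f i]. *)
Lemma complete_row (R : realFieldType) n (tau q : 'I_n -> R) l (sgn : R) :
  (1 < n)%N -> tau l != 0 -> sgn != 0 ->
  exists (f : 'I_n -> 'I_n) (a : 'I_n -> R),
    0 < sgn * \det (\matrix_(i, j) if i == 0%N :> nat then tau j else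
                     a i * ((f i == j)%:R - q (f i) * tau j)).
Proof.
case: n tau q l => [|[|m]]// tau q l _ tl sgn0.
(* For [i != 0], all indices but [l], at which the point has a non-zero
   coordinate. *)
pose f (i : 'I_m.+2) := if unlift ord0 i is Some j then lift l j else l.
pose D := \matrix_(i, j) if i == 0%N :> nat then tau j else (f i == j)%:R - q (f i) * tau j.
have detD : \det D != 0.
  apply/negP => /det0P[v v0 vD]; case/negP: v0; apply/eqP.
  pose K := v 0 ord0 - \sum_i v 0 (lift ord0 i) * q (lift l i).
  have vDE j : K * tau j + \sum_i v 0 (lift ord0 i) * (lift l i == j)%:R = 0.
    move/rowP/(_ j): vD; rewrite !mxE big_ord_recl !mxE /= => vj; apply: etrans vj.
    rewrite /K mulrBl -addrA mulr_suml -sumrN -big_split /=; congr (_ + _).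
    by apply: eq_bigr => i _; rewrite !mxE /f liftK /=; ring.
  have K0 : K = 0.
    have := vDE l; rewrite big1 => [|i _]; last by rewrite eq_sym (negPf (neq_lift _ _)) mulr0.
    by rewrite addr0 => /eqP; rewrite mulf_eq0 (negPf tl) orbF => /eqP.
  have vi i : v 0 (lift ord0 i) = 0.
    have := vDE (lift l i); rewrite K0 mul0r add0r (bigD1 i)//= eqxx mulr1 big1 ?addr0//.
    by move=> j ji; rewrite (inj_eq (@lift_inj _ _)) (negPf ji) mulr0.
  apply/rowP => i; rewrite mxE; case: (unliftP ord0 i) => [j|] ->; first exact: vi.
  by move: K0; rewrite /K big1 ?subr0// => j _; rewrite vi mul0r.
(* The second row exists because there are at least two; it adjusts the sign. *)
pose a (i : 'I_m.+2) := if i == 1%N :> nat then Num.sg (sgn * \det D) else 1.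
exists f, a.
rewrite (_ : \matrix_(i, j) _ = diag_mx (\row_i a i) *m D); last first.
  apply/matrixP => i j; rewrite mul_diag_mx !mxE; case: eqP => // i0.
  by rewrite /a i0 /= mul1r.
rewrite det_mulmx det_diag !big_ord_recl big1 => [|i _]; last by rewrite mxE.
rewrite !mxE /a /= mul1r mulr1 mulrCA -normrEsg normr_gt0.
by rewrite mulf_neq0.
Qed.

Section Facets.
Variables (R : realType) (X : geometry) (n : nat).
Notation V := (ambient R X n).
Notation W := 'rV[R]_(1 + n).
Implicit Types (x w : V) (A : {set vertex n}) (t : vertex n -> R).
Variable P : vertex n -> V.

Lemma point_coordE A x t : point_coord P A x t <->
  (forall v, v \notin A -> t v = 0) /\ hat 1 x = \sum_v t v *: hat 1 (P v) :> W.
Proof.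
rewrite hat_sum; split=> [[h1 h2 h3]|[h1 /hat_inj[h2 h3]]].
  by split=> //; apply/hat_inj; split=> // /h2.
by split=> // /h3.
Qed.

Lemma vector_coordE A x w t : vector_coord P A x w t <->
  [/\ forall v, v \notin A -> t v = 0, hat 0 w = \sum_v t v *: hat 1 (P v) :> W
    & tangent x w].
Proof.
rewrite hat_sum; split=> [[h1 h2 h3 h4]|[h1 /hat_inj[h2 h3] h4]].
  by split=> //; apply/hat_inj; split=> // /h2.
by split=> // /h3.
Qed.

Lemma in_space_dotp x : in_space x -> ~~ is_Euc X -> dotp x x != 0.
Proof.
case: X x => //= x; first by move=> ->; rewrite oner_eq0.
by case=> -> _; rewrite oppr_eq0 oner_eq0.
Qed.

Lemma in_space_neq0 x : in_space x -> hat 1 x != 0 :> W.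
Proof.
move=> xs; apply/eqP => x0.
have : hat 1 x = hat 0 (0 : V) by rewrite x0 hat00.
move/hat_inj => [x00 eX]; rewrite {}x00 in xs => {x0}; move: eX xs.
case: X => /= eX.
- by rewrite dotp0l => /eqP; rewrite eq_sym oner_eq0.
- by move/eqP: (eX isT); rewrite oner_eq0.
- by case; rewrite dotp0l => /eqP; rewrite eq_sym oppr_eq0 oner_eq0.
Qed.

Variables (lam : 'I_n -> R) (u : option R) (c d N : 'I_n -> W) (M : W).
Hypothesis F : flex_frame X lam u c d N M.
Variables (J : {set 'I_n}) (al : 'I_n -> R).
Hypothesis al_neq0 : forall i, al i != 0.
Hypothesis PJ : forall i, hat 1 (P (facet_vertex J i)) = al i *: c i.

(** Coordinates with respect to the vertices of the facet, read off by the dual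
    covectors. *)
Definition frame_coord (y : W) : vertex n -> R := fun v =>
  match v with
  | inl i => if i \in J then 0 else pairing y (N i) / al i
  | inr i => if i \in J then pairing y (N i) / al i else 0
  end.

Lemma frame_coord_out y v : v \notin facet J -> frame_coord y v = 0.
Proof. by rewrite inE; case: v => i /=; rewrite ?inE ?negbK => h; rewrite ?h ?(negPf h). Qed.

Lemma frame_coord_vertex y i :
  frame_coord y (facet_vertex J i) = pairing y (N i) / al i.
Proof. by rewrite /facet_vertex; case: ifP => iJ /=; rewrite iJ. Qed.

Lemma frame_coordE y : pairing y M = 0 ->
  y = \sum_v frame_coord y v *: hat 1 (P v).
Proof.
move=> yM; rewrite (sum_facet _ (frame_coord_out y)).
rewrite [LHS](frame_expand F) yM scale0r add0r; apply: eq_bigr => i _.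
by rewrite frame_coord_vertex PJ scalerA divfK.
Qed.

Lemma facet_pairing t (y : W) : (forall v, v \notin facet J -> t v = 0) ->
  y = \sum_v t v *: hat 1 (P v) ->
  pairing y M = 0 /\ forall i, pairing y (N i) = t (facet_vertex J i) * al i.
Proof.
move=> t0 ->; rewrite (sum_facet _ t0); split=> [|i]; rewrite pairing_suml.
  by rewrite big1// => i _; rewrite PJ !pairingZl (ff_cM F) !mulr0.
rewrite (bigD1 i)//= big1 => [|j ji]; rewrite PJ !pairingZl (ff_cN F).
  by rewrite eqxx mulr1 addr0.
by rewrite (negPf ji) !mulr0.
Qed.

Lemma facet_tangent x w :
  tangent_simplex P (facet J) x w <-> tangent x w /\ pairing (hat 0 w) M = 0.
Proof.
split=> [[t /vector_coordE[t0 wE tw]]|[tw wM]].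
  by split=> //; have [] := facet_pairing t0 wE.
exists (frame_coord (hat 0 w)); apply/vector_coordE; split=> //.
  exact: frame_coord_out.
exact: frame_coordE.
Qed.

Lemma ridge_tangent k x w :
  tangent_simplex P (facet J :\ facet_vertex J k) x w <->
  [/\ tangent x w, pairing (hat 0 w) M = 0 & pairing (hat 0 w) (N k) = 0].
Proof.
split=> [[t /vector_coordE[t0 wE tw]]|[tw wM wN]].
  have [wM wN] : pairing (hat 0 w) M = 0 /\
      forall i, pairing (hat 0 w) (N i) = t (facet_vertex J i) * al i.
    by apply: facet_pairing wE => v vJ; apply: t0; rewrite finset.in_setD1 (negPf vJ) andbF.
  by split=> //; rewrite wN t0 ?mul0r// !inE eqxx.
exists (frame_coord (hat 0 w)); apply/vector_coordE; split=> //; last exact: frame_coordE.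
move=> v; rewrite finset.in_setD1 negb_and negbK => /orP[/eqP ->|]; last exact: frame_coord_out.
by rewrite frame_coord_vertex wN mul0r.
Qed.

Lemma facet_point A x : A \subset facet J -> hull P A x ->
  pairing (hat 1 x) M = 0 /\
  forall i, facet_vertex J i \notin A -> pairing (hat 1 x) (N i) = 0.
Proof.
move=> AJ [_ [t [/point_coordE[t0 xE] _]]].
have tJ v : v \notin facet J -> t v = 0.
  by move=> vJ; apply: t0; apply: contra vJ; apply: (fintype.subsetP AJ).
have [xM xN] := facet_pairing tJ xE.
by split=> // i iA; rewrite xN t0// mul0r.
Qed.

Lemma dotp_grad f w : dotp w (grad f) = pairing (hat 0 w) f.
Proof. by rewrite pairing_hat0. Qed.

(** The common uniqueness argument for the two kinds of unit normals: the
    component of [w] orthogonal to [grad f] has length zero, hence vanishes as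
    the tangent space is positive definite. *)
Lemma unit_multiple x w f : in_space x -> tangent x w -> dotp w w = 1 ->
  tangent x (grad f) -> cometric X f f = 1 ->
  dotp w (w - dotp w (grad f) *: grad f) = 0 ->
  w = dotp w (grad f) *: grad f /\ dotp w (grad f) ^+ 2 = 1.
Proof.
set rho := dotp w (grad f) => xs tw ww tf ff wr.
have gg : dotp (grad f : V) (grad f) = 1 by rewrite -cometric_grad.
have rr : rho ^+ 2 = 1.
  by move: wr; rewrite dotpBr ww dotpZr -/rho => /subr0_eq e; rewrite expr2 -e.
split=> //; apply/eqP; rewrite -subr_eq0; apply/eqP.
apply: contrapT => /eqP r0.
have tr : tangent x (w - rho *: grad f).
  case: tw => [e|tw]; first by left.
  case: tf => [e|tf]; first by left.
  by right; rewrite dotpBr dotpZr tw tf mulr0 subr0.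
have := tangent_pos xs tr r0.
rewrite dotpBl wr dotpZl sub0r dotpBr dotpZr gg mulr1 dotpC -/rho subrr mulr0 oppr0.
by rewrite ltxx.
Qed.

Lemma sgr_id_sqr1 (r : R) : r ^+ 2 = 1 -> Num.sg r = r.
Proof.
by move/eqP; rewrite sqrf_eq1 => /orP[] /eqP ->; rewrite ?sgrN sgr1.
Qed.

Lemma sqr_sgr1 (r : R) : r != 0 -> Num.sg r ^+ 2 = 1.
Proof. by move=> r0; rewrite sqr_sg r0. Qed.

(** [grad (N k)] is orthogonal to the ridge opposite to the vertex number [k], and
    this vertex lies on the side given by the sign of [al k]. *)
Lemma inner_normalE k x w : hull P (facet J :\ facet_vertex J k) x ->
  inner_normal P (facet J :\ facet_vertex J k) (facet J) x w <->
  w = Num.sg (al k) *: grad (N k).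
Proof.
move=> hx; have xs : in_space x by case: hx.
have [|xM xN] := facet_point _ hx; first exact: subD1set.
have xNk : tangent x (grad (N k)).
  by apply: pairing_hat1_tangent; apply: xN; rewrite !inE eqxx.
have NN : dotp (grad (N k) : V) (grad (N k)) = 1 by rewrite -cometric_grad (ff_NN F).
have NM : pairing (hat 0 (grad (N k) : V)) M = 0 by rewrite hat_grad; exact: (ff_NM F).
have hZ a y f : pairing (hat 0 (a *: (y : V))) f = a * pairing (hat 0 y) f.
  by rewrite !pairing_hat0 dotpZl.
split=> [[[t [/vector_coordE[t0 wE tw] tpos]] ww orth]|->].
  have [wM wN] := facet_pairing t0 wE.
  have [|wE' rr] := @unit_multiple x w (N k) xs tw ww xNk (ff_NN F k).
    apply: orth; apply/ridge_tangent; split.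
    - case: tw => [e|tw]; first by left.
      case: xNk => [e|xNk]; first by left.
      by right; rewrite dotpBr dotpZr tw xNk mulr0 subr0.
    - by rewrite pairing_hat0 dotpBl dotpZl -!pairing_hat0 wM NM mulr0 subr0.
    - by rewrite pairing_hat0 dotpBl dotpZl NN mulr1 subrr.
  rewrite {1}wE'; congr (_ *: _); rewrite -[LHS](sgr_id_sqr1 rr) dotp_grad wN sgrM.
  rewrite [Num.sg (t _)]gtr0_sg ?mul1r//; apply: tpos.
  by rewrite finset.in_setD finset.in_setD1 eqxx facet_vertexP.
split.
- exists (frame_coord (hat 0 (Num.sg (al k) *: grad (N k) : V))); split.
    apply/vector_coordE; split; first exact: frame_coord_out.
      by apply: frame_coordE; rewrite hZ NM mulr0.
    case: xNk => [e|xNk]; first by left.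
    by right; rewrite dotpZr xNk mulr0.
  move=> v; rewrite finset.in_setD finset.in_setD1 => /andP[]; rewrite negb_and negbK.
  move=> /orP[/eqP -> _|/negPf -> //].
  rewrite frame_coord_vertex hZ hat_grad -/(cometric X _ _) (ff_NN F) mulr1.
  by rewrite {2}[al k]numEsg invfM mulrA divff ?sgr_eq0// mul1r invr_gt0 normr_gt0.
- by rewrite dotpZl dotpZr NN mulr1 -expr2 sqr_sgr1.
- move=> z /ridge_tangent[tz zM zN].
  by rewrite dotpZl dotpC dotp_grad zN mulr0.
Qed.

(** In homogeneous coordinates the orientation is given by the same determinant
    in the three spaces. *)
Lemma det_seq_hat x (e : seq V) : size e = n ->
  det_seq (if is_Euc X then e else x :: e) =
  \det (\matrix_(i < 1 + n) nth 0 (hat 1 x :: map (hat 0) e) i).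
Proof.
move=> se; rewrite /det_seq; clear F al_neq0 PJ; move: x e se; case: X => /= x e se.
- by rewrite map_id.
- rewrite (_ : \matrix_(i < 1 + n) _ = block_mx 1%:M x 0 (\matrix_(i < n) nth 0 e i)).
    by rewrite det_ublock det1 mul1r.
  apply/row_matrixP => i; rewrite rowK; case: (split_ordP i) => j ->.
    rewrite ord1 /block_mx /= rowKu row_row_mx !row_id; congr row_mx.
    by apply/rowP => l; rewrite !mxE ord1.
  rewrite /block_mx rowKd /= ?add0n (nth_map 0) ?se//.
  by rewrite row_row_mx rowK; congr row_mx; apply/rowP => l; rewrite !mxE.
- by rewrite map_id.
Qed.

(** When [w] is a multiple of the normal [grad M], exchanging the rows of [x] and
    [w] makes the frame block diagonal in the basis [basis_mx]; the exchange
    accounts for the minus sign. *)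
Lemma frame_det (n0 : (0 < n)%N) x w (e : seq V) (D : 'I_n -> vertex n -> R) a :
  size e = n.-1 ->
  (forall i v, v \notin facet J -> D i v = 0) ->
  (forall i : 'I_n, (if i == 0%N :> nat then hat 1 x else hat 0 (nth 0 e i.-1)) =
      \sum_v D i v *: hat 1 (P v)) ->
  w = a *: grad M ->
  det_seq (if is_Euc X then w :: e else x :: w :: e) =
  - a * \det (\matrix_(i, j) D i (facet_vertex J j)) * \prod_i al i * \det (basis_mx X c M).
Proof.
move=> se D0 DE wE.
rewrite det_seq_hat /= ?se ?prednK//.
pose S' := block_mx a%:M 0 0 ((\matrix_(i, j) D i (facet_vertex J j)) *m diag_mx (\row_i al i))
   *m basis_mx X c M.
pose i0 : 'I_(1 + n) := lshift n 0; pose i1 : 'I_(1 + n) := rshift 1 (Ordinal n0).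
have -> : \matrix_(i < 1 + n) nth 0 [:: hat 1 x, hat 0 w & map (hat 0) e] i = xrow i0 i1 S'.
  have SE : S' = col_mx (hat 0 w)
      (\matrix_(i < n) (if i == 0%N :> nat then hat 1 x else hat 0 (nth 0 e i.-1))).
    rewrite /S' /basis_mx mul_block_col !mul0mx addr0 add0r; congr col_mx.
      by rewrite wE mul_scalar_mx -hat_grad hatZ mulr0.
    apply/row_matrixP => i; rewrite rowK DE (sum_facet _ (D0 i)) row_mul mulmx_sum_row.
    apply: eq_bigr => j _; rewrite rowK PJ scalerA; congr (_ *: _).
    rewrite !mxE (bigD1 j)//= big1 ?addr0 => [|l lj]; rewrite !mxE ?eqxx ?mulr1n//.
    by rewrite (negPf lj) mulr0n mulr0.
  have rp p q (A : 'M[R]_(p, q)) s i : row i (row_perm s A) = row (s i) A.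
    by apply/rowP => l; rewrite !mxE.
  apply/row_matrixP => i; rewrite rowK SE /xrow rp.
  case: tpermP => [->|->|/eqP h0 /eqP h1].
  - by rewrite /i1 rowKd rowK.
  - by rewrite /i0 rowKu row_id.
  case: (split_ordP i) h0 h1 => j ->; first by rewrite ord1 eqxx.
  move=> _ h1; have j0 : nat_of_ord j != 0%N.
    by apply: contraNneq h1 => j0; apply/eqP/val_inj; rewrite /= j0.
  have nthE l : l != 0%N -> (l < n)%N ->
      nth 0 (hat 0 w :: map (hat 0) e) l = hat 0 (nth 0 e l.-1) :> W.
    by case: l => //= l _ ln; rewrite (nth_map 0)// se; case: (n) ln.
  by rewrite rowKd rowK (negPf j0); exact: nthE.
rewrite /xrow row_permE det_mulmx det_perm odd_tperm /S' det_mulmx.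
have -> : i0 != i1 by rewrite -val_eqE.
rewrite expr1 det_ublock det_scalar1 det_mulmx det_diag.
have -> : \prod_i (\row_i al i) 0 i = \prod_i al i by apply: eq_bigr => i _; rewrite mxE.
by ring.
Qed.

(** The definition of the exterior normal quantifies over all positive frames of
    the facet; it determines the sign of the normal only if there is one. *)
Lemma exists_facet_frame x : (1 < n)%N -> in_space x -> pairing (hat 1 x) M = 0 ->
  exists e, facet_frame P J x e.
Proof.
move=> n1 xs xM; pose t := frame_coord (hat 1 x).
have t0 : forall v, v \notin facet J -> t v = 0 := @frame_coord_out (hat 1 x).
have tE : hat 1 x = \sum_v t v *: hat 1 (P v) := frame_coordE xM.
have [l tl] : exists l, t (facet_vertex J l) != 0.
  apply: contrapT => tl; move/eqP: (in_space_neq0 xs); apply.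
  rewrite tE (sum_facet _ t0) big1// => i _.
  have [e0|ti] := eqVneq (t (facet_vertex J i)) 0; first by rewrite e0 scale0r.
  by case: tl; exists i.
pose q i := if is_Euc X then 1 else dotp (P (facet_vertex J i)) x / dotp x x.
have [|f [a Da]] := @complete_row _ _ (fun i => t (facet_vertex J i)) q l (facet_sign R J) n1 tl.
  by rewrite /facet_sign signr_eq0.
(* The tangential part of the vertex number [f i]. *)
pose g i := a i *: (P (facet_vertex J (f i)) - q (f i) *: x).
pose dd (i : 'I_n) v := if i == 0%N :> nat then t v else
  a i * ((facet_vertex J (f i) == v)%:R - q (f i) * t v).
exists [seq g i | i <- behead (enum 'I_n)]; split.
  by rewrite size_map size_behead size_enum_ord.
exists t, dd; split.
- by apply/point_coordE.
- by move=> i i0; apply/funext => v; rewrite /dd i0.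
- move=> i i0; have iE : nth 0 [seq g i | i <- behead (enum 'I_n)] i.-1 = g i.
    rewrite (nth_map i) ?nth_behead ?prednK ?nth_ord_enum//.
    by rewrite size_behead size_enum_ord -ltnS !prednK// ltnW.
  rewrite iE; apply/vector_coordE; split.
  - move=> v vJ; rewrite /dd -[_ == _ :> nat]negbK -lt0n i0 /= t0// mulr0 subr0.
    rewrite (_ : (_ == v) = false) ?mulr0//.
    by apply: contraNF vJ => /eqP <-; exact: facet_vertexP.
  - transitivity (a i *: (hat 1 (P (facet_vertex J (f i))) - q (f i) *: hat 1 x)).
      rewrite /g -!scaleNr hatZ hatD hatZ; apply/hat_inj; split=> // eX.
      by rewrite /q eX; ring.
    rewrite tE scaler_sumr -sumrN.
    rewrite [X in X + _](_ : _ = \sum_v (facet_vertex J (f i) == v)%:R *: hat 1 (P v)).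
      rewrite -big_split scaler_sumr; apply: eq_bigr => v _.
      rewrite /dd -[_ == 0%N]negbK -lt0n i0 /= -/t.
      by rewrite scalerA -scaleNr -scalerDl scalerA.
    rewrite (bigD1 (facet_vertex J (f i)))//= eqxx scale1r big1 ?addr0// => v /negPf vi.
    by rewrite eq_sym vi scale0r.
  - rewrite /tangent; have [eX|nE] := boolP (is_Euc X); [by left | right].
    rewrite /g dotpZr dotpBr dotpZr /q (negPf nE) divfK ?[dotp x (P _)]dotpC ?subrr ?mulr0//.
    exact: in_space_dotp.
- rewrite (_ : \matrix_(i, j) _ = \matrix_(i, j) if i == 0%N :> nat then t (facet_vertex J j) else
                     a i * ((f i == j)%:R - q (f i) * t (facet_vertex J j)))//.
  apply/matrixP => i j; rewrite !mxE /dd; case: ifP => // _.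
  by rewrite (inj_eq (@facet_vertex_inj _ _)).
Qed.

Lemma exterior_normalE (o : R) x w : (1 < n)%N -> o != 0 ->
  in_space x -> pairing (hat 1 x) M = 0 ->
  exterior_normal P o J x w <->
  w = - Num.sg (o * facet_sign R J * \prod_i al i * \det (basis_mx X c M)) *: grad M.
Proof.
move=> n1 o0 xs xM; set K := o * _ * _ * _.
have n0 : (0 < n)%N by exact: ltnW.
have det0 : \det (basis_mx X c M) != 0.
  by apply/negP => /eqP d0; have := congr1 determinant (basis_dual F);
    rewrite det_mulmx d0 mul0r det1 => /esym/eqP; rewrite oner_eq0.
have K0 : K != 0.
  by rewrite /K !mulf_neq0// ?signr_eq0//; apply/prodf_neq0 => i _; exact: al_neq0.
have tM : tangent x (grad M) by exact: pairing_hat1_tangent.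
have MM : dotp (grad M : V) (grad M) = 1 by rewrite -cometric_grad (ff_MM F).
have pos a e : facet_frame P J x e -> w = a *: grad M ->
    positive_frame o x (w :: e) <-> a * K < 0.
  move=> [se [t [D [tx D0 D1 Dpos]]]] wE; rewrite /positive_frame.
  have [t0 xE] := (point_coordE _ _ _).1 tx.
  rewrite (frame_det n0 (D := D) se _ _ wE).
  - set p := \det _; rewrite -oppr_gt0 -(pmulr_rgt0 _ Dpos) -/p /K.
    suff -> : o * (- a * p * \prod_i al i * \det (basis_mx X c M)) =
      facet_sign R J * p *
      - (a * (o * facet_sign R J * \prod_i al i * \det (basis_mx X c M))) by [].
    have e1 : facet_sign R J * facet_sign R J = 1 by rewrite /facet_sign -expr2 sqrr_sign.
    set r := \prod_i _; set b := \det _; rewrite -[LHS]mul1r -e1.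
    by ring.
  - move=> i v vJ; have [i0|i0] := posnP i; first by rewrite D0// t0.
    by case: (D1 i i0) => ->.
  - move=> i; have [i0|i0] := posnP i; first by rewrite D0//= -xE.
    by case/vector_coordE: (D1 i i0).
split=> [[tw ww orth wpos]|wE].
  have [|wE rr] := @unit_multiple x w M xs tw ww tM (ff_MM F).
    apply: orth; apply/facet_tangent; split.
      case: tw => [e|tw]; first by left.
      case: tM => [e|tM]; first by left.
      by right; rewrite dotpBr dotpZr tw tM mulr0 subr0.
    by rewrite pairing_hat0 dotpBl dotpZl MM mulr1 subrr.
  have [e he] := exists_facet_frame n1 xs xM.
  have /(pos _ _ he wE) aK := wpos _ he.
  rewrite {1}wE; congr (_ *: _); rewrite -[LHS](sgr_id_sqr1 rr).
  have : Num.sg (dotp w (grad M) * K) = -1 by rewrite ltr0_sg.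
  rewrite sgrM => /(congr1 (fun z => z * Num.sg K)).
  by rewrite -mulrA -expr2 sqr_sgr1// mulr1 mulN1r.
split.
- case: tM => [e|tM]; first by left.
  by right; rewrite wE dotpZr tM mulr0.
- by rewrite wE dotpZl dotpZr MM mulr1 -expr2 sqrrN sqr_sgr1.
- by move=> z /facet_tangent[_ zM]; rewrite wE dotpZl dotpC dotp_grad zM mulr0.
- move=> e he; apply/(pos _ _ he wE).
  by rewrite mulNr -normrEsg oppr_lt0 normr_gt0.
Qed.
End Facets.

(** * The frame of the base facet *)

Lemma exists_notin n (A : {set 'I_n}) : (#|A| < n)%N -> exists l, l \notin A.
Proof.
move=> An; have : (0 < #|~: A|)%N by rewrite cardsCs finset.setCK card_ord subn_gt0.
by case/card_gt0P => l; rewrite inE => lA; exists l.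
Qed.

Section Base.
Variables (R : realType) (X : geometry) (n : nat).
Notation V := (ambient R X n).
Notation W := 'rV[R]_(1 + n).
Variables (lam : 'I_n -> R) (u : option R).

(** With the [d i] defined as in the construction, only the duality relations and
    the lengths of the covectors remain to be checked. *)
Lemma mk_frame (h : 'I_n -> 'I_n -> R) (c N : 'I_n -> W) (M : W) :
  (forall i j, pairing (c i) (N j) = (i == j)%:R) ->
  (forall i, pairing (c i) M = 0) ->
  (forall i, cometric X (N i) (N i) = 1) ->
  (forall i, cometric X (N i) M = 0) ->
  cometric X M M = 1 ->
  (forall i, h i i = 1) ->
  (forall i j, i != j -> h i j = hentry (lam i) (lam j) (cometric X (N i) (N j))) ->
  flex_frame X lam u c
    (fun i => \sum_j h i j *: c j + (- coef_n (lam i) u) *: sharp X (N i)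
      + coef_m (lam i) u *: sharp X M) N M.
Proof.
move=> cN cM NN NM MM hii hij.
have sumN i j : pairing (\sum_l h i l *: c l) (N j) = h i j.
  rewrite pairing_suml (bigD1 j)//= big1 => [|l lj]; rewrite pairingZl cN.
    by rewrite eqxx mulr1 addr0.
  by rewrite (negPf lj) mulr0.
have sumM i : pairing (\sum_l h i l *: c l) M = 0.
  by rewrite pairing_suml big1// => l _; rewrite pairingZl cM mulr0.
split=> // [i|i j ij|i]; rewrite !bilinE -!/(cometric X _ _) ?sumN ?sumM.
- by rewrite hii NN [cometric X M _]cometricC NM; ring.
- by rewrite hij// [cometric X M _]cometricC NM; ring.
- by rewrite NM MM; ring.
Qed.

Variables (G : 'M[R]_n) (s s' : 'I_n -> R) (nv : 'I_n -> V) (m : V).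
Variable P : option R -> vertex n -> V.
Hypothesis nvG : forall i j, dotp (nv i) (nv j) = G i j.
Hypothesis Gii : forall i, G i i = 1.
Hypothesis mnv : forall i, dotp m (nv i) = 0.
Hypothesis mm : dotp m m = 1.
Hypothesis ss : forall i, (s i = 1 \/ s i = -1) /\ (s' i = 1 \/ s' i = -1).

(** [al] and [be] are the factors by which the vertices differ from the [c i] and
    the [d i]. *)
Definition base_frame := exists c d N M al be,
  [/\ flex_frame X lam u c d N M, grad M = m,
      forall i, hat 1 (P u (inl i)) = al i *: c i,
      forall i, hat 1 (P u (inr i)) = be i *: d i
    & forall i, Num.sg (al i) = s i /\ Num.sg (be i) = s' i].

Lemma sgr_sign (a : R) : a = 1 \/ a = -1 -> Num.sg a = a.
Proof. by case=> ->; rewrite ?sgrN sgr1. Qed.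

(** Here the vectors [c i], [d i] are those of the construction; the vertices lie
    in the space, so that the norms by which they are divided are not zero. *)
Lemma curved_base : ~~ is_Euc X -> (forall v, in_space (P u v)) ->
  curved_vertices G lam s s' nv m P -> base_frame.
Proof.
move=> nE Pin [c [cin cnv _ Pc _]].
have hatE e (x : V) : hat e x = hat 0 x :> W.
  by apply/hat_inj; split=> // e'; rewrite e' in nE.
have cm i : dotp (c i) m = 0.
  have /submxP[y ->] := cin i; rewrite mulmx_sum_row dotp_suml big1// => j _.
  by rewrite rowK dotpZl dotpC mnv mulr0.
have sgP a (x y : V) : in_space y -> y = (a / vnorm x) *: x ->
    a = 1 \/ a = -1 -> Num.sg (a / vnorm x) = a.
  move=> yin yE aS; rewrite sgrM sgr_sign// sgrV gtr0_sg ?mulr1//.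
  rewrite lt_def sqrtr_ge0 andbT; apply/eqP => v0.
  move/eqP: (in_space_neq0 yin); apply.
  by rewrite yE v0 invr0 mulr0 scale0r (hatE 1) hat00.
pose N i : W := flat 0 (nv i); pose M : W := flat 0 m.
have F := @mk_frame (hcoef G lam) (fun i => hat 0 (c i)) N M.
pose d i := \sum_j hcoef G lam i j *: c j - coef_n (lam i) u *: nv i + coef_m (lam i) u *: m.
exists (fun i => hat 0 (c i)); eexists; exists N, M,
  (fun i => s i / vnorm (c i)), (fun i => s' i / vnorm (d i)); split.
- apply: F => [i j|i|i|i||i|i j ij]; rewrite ?pairing_hat0 ?cometric_grad ?grad_flat //.
  + by rewrite nvG.
  + by rewrite dotpC.
  + by rewrite /hcoef eqxx.
  + by rewrite /hcoef (negPf ij) nvG.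
- exact: grad_flat.
- by move=> i; rewrite hatZ mulr0 -(hatE 1); have [-> _] := Pc u i.
- move=> i; have [_ ->] := Pc u i; rewrite -!hat_grad !grad_flat.
  rewrite -hat0_sum !hatZ !mulr0 !hatD !addr0 hatZ mulr0 scaleNr.
  exact: hatE.
- move=> i; have [si s'i] := ss i; have [Pa Pb] := Pc u i.
  by split; [apply: sgP Pa si | apply: sgP Pb s'i].
Qed.

Lemma pairing_flat e b (x v : V) : is_Euc X ->
  pairing (hat e x) (flat b v) = e * b + dotp x v.
Proof.
move=> eX; transitivity (pairing (hat e (0 : V)) (flat b v) + pairing (hat 0 x) (flat b v)).
  by rewrite -pairingDl hatD addr0 add0r.
rewrite pairing_hat0 grad_flat; congr (_ + _).
move: x v eX; case: X => //= x v _; rewrite pairingE big_split_ord /= big_ord1.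
rewrite !row_mxEl !mxE big1 ?addr0// => i _.
by rewrite row_mxEr mxE mul0r.
Qed.

(** The component [y] of the altitude orthogonal to [nv i] is also orthogonal to
    [m] and to the opposite facet; together these span the space, by
    [frame_expand], so that [y] vanishes. It follows that alt_i, defined as a length with a sign, is the value at [a i]
    of the affine function with gradient [nv i] that vanishes on the opposite
    facet. *)
Lemma altitude_normal (a : 'I_n -> V) (N : 'I_n -> W) (M : W) (e : 'I_n -> R) i j f t :
  is_Euc X ->
  (forall i, e i != 0) ->
  (exists d, flex_frame X lam u (fun i => (e i)^-1 *: hat 1 (a i)) d N M) ->
  (forall i, grad (N i) = nv i) -> grad M = m ->
  (forall k l, dotp (a k - a l) m = 0) ->
  (forall k l, k != i -> l != i -> dotp (a k - a l) (nv i) = 0) ->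
  j != i -> point_coord a [set~ i] f t ->
  (forall k l, k != i -> l != i -> dotp (a i - f) (a k - a l) = 0) ->
  a i - f = dotp (a i - a j) (nv i) *: nv i.
Proof.
move=> eX e0 [d F] gN gM am an ji [t0 /(_ eX) t1 fE] aif.
have proj v : (forall k, k != i -> dotp (a k - a j) v = 0) -> dotp (f - a j) v = 0.
  move=> av; rewrite (_ : f - a j = \sum_k t k *: (a k - a j)).
    rewrite dotp_suml big1// => k _; rewrite dotpZl.
    have [->|ki] := eqVneq k i; first by rewrite t0 ?mul0r// !inE eqxx.
    by rewrite av// mulr0.
  under eq_bigr do rewrite scalerBr.
  by rewrite sumrB -scaler_suml t1 scale1r -fE.
set z := a i - f; set k0 := dotp z (nv i).
have k0E : k0 = dotp (a i - a j) (nv i).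
  rewrite /k0 /z !dotpBl; have := proj (nv i) (fun k ki => an k j ki ji).
  by rewrite dotpBl => /subr0_eq ->.
rewrite -k0E; apply/eqP; rewrite -subr_eq0; apply/eqP; apply: contrapT => /eqP y0.
set y := z - _ in y0.
have : 0 < dotp y y.
  apply: (@tangent_pos _ _ _ 0) y0; last by left.
  by case: (X) eX.
have yN : pairing (hat 0 y) (N i) = 0.
  by rewrite pairing_hat0 gN /y dotpBl dotpZl -/k0 nvG Gii mulr1 subrr.
have yM : pairing (hat 0 y) M = 0.
  rewrite pairing_hat0 gM /y dotpBl dotpZl [dotp (nv i) m]dotpC mnv mulr0 subr0.
  rewrite /z dotpBl; have := proj m (fun k _ => am k j); have := am i j.
  by rewrite !dotpBl => /subr0_eq -> /subr0_eq ->; rewrite subrr.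
have := frame_expand F (hat 0 y); rewrite yM scale0r add0r => yE.
have <- : pairing (hat 0 y) (flat (- dotp (a j) y) y) = dotp y y.
  by rewrite pairing_flat// mul0r add0r.
rewrite yE pairing_suml big1 ?ltxx// => k _; rewrite pairingZl.
have [->|ki] := eqVneq k i; first by rewrite yN mul0r.
rewrite pairingZl pairing_flat// mul1r addrC -dotpBl dotpC /y dotpBl dotpZl.
by rewrite aif// [dotp (nv i) _]dotpC an// !mulr0 subr0 !mulr0.
Qed.

(** The vectors of the frame are c_i = (1, a_i) / alt_i and d_i = (1, b_i(u)) / b_i;
    the condition that the first coordinate of d_i is 1 / b_i is the definition
    of the number b_i. *)
Lemma euclidean_base : is_Euc X -> (1 < n)%N ->
  euclidean_vertices G lam s s' nv m P -> base_frame.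
Proof.
move=> eX n1 [a [alt [b [[_ [p am]] an sgn [altE bE] Pab]]]].
have /choice[nx nxE] : forall i : 'I_n, exists j : 'I_n, j != i.
  move=> i; have [|j] := @exists_notin n [set i]; first by rewrite cards1.
  by rewrite inE; exists j.
pose e i := dotp (a i - a (nx i)) (nv i).
have sgE i : Num.sg (e i) = s i.
  rewrite /e dotpC; case: (sgn i) => -[-> /(_ (nx i) (nxE i))].
    by move/gtr0_sg.
  by move/ltr0_sg.
have e0 i : e i != 0.
  by rewrite -sgr_eq0 sgE; case: (ss i) => -[->|->] _; rewrite ?oppr_eq0 oner_eq0.
pose N i : W := flat (- dotp (a (nx i)) (nv i)) (nv i); pose M : W := flat (- p) m.
have gN i : grad (N i) = nv i by exact: grad_flat.
have gM : grad M = m by exact: grad_flat.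
pose c i : W := (e i)^-1 *: hat 1 (a i).
have F : flex_frame X lam u c (fun i => \sum_j hcoef G lam i j *: c j
    + (- coef_n (lam i) u) *: sharp X (N i) + coef_m (lam i) u *: sharp X M) N M.
  apply: (@mk_frame (hcoef G lam)) => [i j|i|i|i||i|i j ij];
    rewrite /c ?cometric_grad ?gN ?gM ?pairingZl ?pairing_flat ?mul1r //.
  - rewrite addrC -dotpBl; have [->|ij] := eqVneq i j; first by rewrite mulVf.
    by rewrite an// mulr0.
  - by rewrite am addNr mulr0.
  - by rewrite nvG.
  - by rewrite dotpC.
  - by rewrite /hcoef eqxx.
  - by rewrite /hcoef (negPf ij) nvG.
have alt_e i : alt i = e i.
  have [len [[f [[t tf] aif ->]] ->]] := altE i.
  rewrite (@altitude_normal a N M e i (nx i) f t eX e0 _ gN gM _ _ (nxE i) tf aif).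
  - rewrite -/(e i) /vnorm dotpZl dotpZr nvG Gii mulr1 -expr2 ger0_norm ?sqr_ge0//.
    by rewrite sqrtr_sqr -sgE -numEsg.
  - by eexists; exact: F.
  - by move=> k l; rewrite dotpBl !am subrr.
  - by move=> k l ki li; exact: an.
eexists _, _, N, M, e, b; split; first exact: F.
- exact: gM.
- by move=> i; have [-> _] := Pab u i; rewrite scalerA divff// scale1r.
- move=> i; have [_ ->] := Pab u i; have [h0 bEi _] := bE i.
  rewrite -!hat_grad gN gM.
  rewrite (eq_bigr (fun j => (hcoef G lam i j / alt j) *: hat 1 (a j))) => [|j _]; last first.
    by rewrite scalerA alt_e.
  rewrite hat_sum !hatZ !hatD !mulr0 !addr0 hatZ scaleNr; congr (hat _ _).
  by rewrite bEi mulVf.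
- move=> i; have [_ bEi s'E] := bE i; split; first exact: sgE.
  by rewrite s'E.
Qed.
End Base.

(** * Signs of the vertices seen from an arbitrary facet *)

Lemma sgr_stretch_factor (R : realType) (lk li g : R) :
  0 < lk -> 0 < li -> lk != li -> -1 < g < 1 ->
  Num.sg (stretch_factor lk li g) = if li < lk then 1 else -1.
Proof.
move=> k0 i0 ki /andP[g1 g2]; rewrite /stretch_factor sgrM sgrV gtr0_sg ?mul1r; last first.
  by have : 0 <= (lk - li) ^+ 2 := sqr_ge0 _; have : 0 < lk * li := mulr_gt0 k0 i0; nra.
have -> : lk ^+ 2 - li ^+ 2 = (lk - li) * (lk + li) by ring.
rewrite sgrM [Num.sg (lk + li)]gtr0_sg ?addr_gt0// mulr1.
case: ltgtP ki => // h _; first by rewrite gtr0_sg ?subr_gt0.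
by rewrite ltr0_sg ?subr_lt0.
Qed.

Section Walk.
Variables (R : realType) (X : geometry) (n : nat).
Notation V := (ambient R X n).
Notation W := 'rV[R]_(1 + n).
Variables (lam : 'I_n -> R) (u : option R).
Variables (s s' : 'I_n -> R) (P : vertex n -> V) (o : R).
Hypothesis lam_gt0 : forall i, 0 < lam i.
Hypothesis lam_incr : forall i j : 'I_n, (i < j)%N -> lam i < lam j.
Hypothesis ss : forall i, (s i = 1 \/ s i = -1) /\ (s' i = 1 \/ s' i = -1).
Hypothesis Pin : forall v, in_space (P v).
Hypothesis Hn : (3 <= n)%N \/ X = Sph.

Lemma lam_ltE (i j : 'I_n) : (lam i < lam j) = (i < j)%N.
Proof.
case: (ltngtP i j) => [/lam_incr //|/lam_incr/lt_gtF //|/val_inj ->]; exact: ltxx.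
Qed.

Lemma lam_neq i j : i != j -> lam i != lam j.
Proof.
by rewrite -val_eqE neq_ltn => /orP[] /lam_incr; [move/lt_eqF-> | move/gt_eqF->].
Qed.

Lemma lam_sq_neq i j : i != j -> lam i ^+ 2 - lam j ^+ 2 != 0.
Proof.
move=> ij; have -> : lam i ^+ 2 - lam j ^+ 2 = (lam i - lam j) * (lam i + lam j) by ring.
by rewrite mulf_neq0 ?subr_eq0 ?lam_neq// gt_eqF ?addr_gt0.
Qed.

Section Gram.
Variables (c d N : 'I_n -> W) (M : W) (J : {set 'I_n}) (al : 'I_n -> R).
Hypothesis F : flex_frame X lam u c d N M.
Hypothesis PJ : forall i, hat 1 (P (facet_vertex J i)) = al i *: c i.

(** Strict Cauchy-Schwarz inequality for two covectors that vanish at a common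
    point, namely at a third vertex of the facet; on the sphere the form is
    positive definite and no third vertex is needed. *)
Lemma gram_bound i k : i != k -> -1 < cometric X (N k) (N i) < 1.
Proof.
move=> ik.
have pos (a : R) : a ^+ 2 = 1 -> 0 < 2 + 2 * a * cometric X (N k) (N i).
  move=> a1; have -> : 2 + 2 * a * cometric X (N k) (N i) =
      cometric X (N k + a *: N i) (N k + a *: N i).
    rewrite !bilinE !(ff_NN F) [cometric X (N i) _]cometricC.
    by transitivity (1 + a ^+ 2 + 2 * a * cometric X (N k) (N i)); [rewrite a1; ring | ring].
  apply: cometric_pos.
    apply/eqP => f0; have := pairingDr (c k) (N k) (a *: N i).
    rewrite f0 pairingZr !(ff_cN F) eqxx eq_sym (negPf ik) /pairing trmx0 mulmx0 mxE.
    by rewrite mulr0 addr0 => /eqP; rewrite eq_sym oner_eq0.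
  case: Hn => [n3|XS]; [right|by left].
  have [|l] := @exists_notin n [set i; k].
    by rewrite cards2 ik; exact: n3.
  rewrite !inE negb_or => /andP[li lk].
  exists (P (facet_vertex J l)); first exact: Pin.
  rewrite PJ pairingZl pairingDr pairingZr !(ff_cN F) (negPf li) (negPf lk).
  by rewrite mulr0 addr0 mulr0.
have := pos 1 (expr1n _ _); have := pos (-1); rewrite sqrrN expr1n => /(_ erefl).
by lra.
Qed.

Lemma sgr_stretch i k : i != k -> Num.sg (stretch X lam N k i) = (-1) ^+ (k < i)%N.
Proof.
move=> ik; have ki : k != i by rewrite eq_sym.
rewrite /stretch (sgr_stretch_factor (lam_gt0 k) (lam_gt0 i) (lam_neq ki) (gram_bound ik)) lam_ltE.
by case: (ltngtP i k) ik => // /val_inj ->; rewrite eqxx.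
Qed.

Lemma stretch_neq0 i k : i != k -> stretch X lam N k i != 0.
Proof. by move=> ik; rewrite -sgr_eq0 sgr_stretch// signr_eq0. Qed.
End Gram.

(** The sign of the vertex number [i] of the facet [J] relative to the vector
    [c i] of the frame of this facet: each flip at [j] has changed the signs
    with numbers [i > j]. *)
Definition vertex_sign (s s' : 'I_n -> R) (J : {set 'I_n}) (i : 'I_n) : R :=
  (if i \in J then s' i else s i) * (-1) ^+ #|[set j in J | (j < i)%N]|.

(** The last condition says that the exterior normal to the facet [J] is
    [grad M] times minus the product of all [s j * s' j] with [j \in J]. *)
Definition frame_at (J : {set 'I_n}) := exists c d N M al be,
  [/\ flex_frame X lam u c d N M,
      forall i, hat 1 (P (facet_vertex J i)) = al i *: c i,
      forall i, hat 1 (P (facet_vertex (~: J)%SET i)) = be i *: d i,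
      forall i, Num.sg (al i) = vertex_sign s s' J i /\
                Num.sg (be i) = vertex_sign s' s J i
    & Num.sg (o * facet_sign R J * \prod_i al i * \det (basis_mx X c M)) =
      \prod_(j in J) (s j * s' j)].

Lemma sign_sqr a : a = 1 \/ a = -1 -> a * a = 1 :> R.
Proof. by case=> ->; rewrite ?mulrNN mulr1. Qed.

Lemma vertex_sign_neq0 (r r' : 'I_n -> R) J i :
  (r i = 1 \/ r i = -1) -> (r' i = 1 \/ r' i = -1) -> vertex_sign r r' J i != 0.
Proof.
move=> ri ri'; rewrite mulf_neq0 ?signr_eq0//.
by case: ifP => _; [case: ri' => -> | case: ri => ->]; rewrite ?oppr_eq0 oner_eq0.
Qed.

Lemma vertex_signU1 (r r' : 'I_n -> R) (J : {set 'I_n}) (k i : 'I_n) : k \notin J ->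
  i != k -> vertex_sign r r' (k |: J) i = vertex_sign r r' J i * (-1) ^+ (k < i)%N.
Proof.
move=> kJ ik; rewrite /vertex_sign in_setU1 (negPf ik) /= -mulrA -exprD; congr (_ * _ ^+ _).
case: ltnP => ki.
  rewrite addn1 (_ : [set j in k |: J | (j < i)%N] = k |: [set j in J | (j < i)%N]).
    by rewrite cardsU1 !inE (negPf kJ).
  by apply/setP => j; rewrite !inE andb_orl; case: eqP => // ->; rewrite ki.
rewrite addn0; congr #|pred_of_set _|; apply/setP => j; rewrite !inE.
by case: (eqVneq j k) => //= ->; rewrite ltnNge ki (negPf kJ).
Qed.

Lemma vertex_signU1k (r r' : 'I_n -> R) (J : {set 'I_n}) (k : 'I_n) : k \notin J ->
  vertex_sign r r' (k |: J) k = vertex_sign r' r J k.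
Proof.
move=> kJ; rewrite /vertex_sign in_setU1 eqxx (negPf kJ) /=; congr (_ * _ ^+ _).
congr #|pred_of_set _|; apply/setP => j; rewrite !inE.
by case: (eqVneq j k) => //= ->; rewrite ltnn andbF.
Qed.

(** In the orientation condition the stretch factors in the determinant cancel
    against those in the product of the [al i], and the minus sign of
    [det_basis_flip] against the change of [facet_sign]. *)
Lemma frame_atU1 (J : {set 'I_n}) k : k \notin J -> frame_at J -> frame_at (k |: J)%SET.
Proof.
move=> kJ [c [d [N [M [al [be [F PJ PJ' sg or]]]]]]].
have st0 i : i != k -> stretch X lam N k i != 0 by exact: (stretch_neq0 F PJ).
have al0 i : al i != 0.
  by rewrite -sgr_eq0 (sg i).1 vertex_sign_neq0//; case: (ss i).
exists (flipc X lam c d N k), (flipd X lam c d N k), (flipN X lam u N M k), (flipM lam u N M k).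
exists (fun i => if i == k then be k else al i / stretch X lam N k i).
exists (fun i => if i == k then al k else be i * stretch X lam N k i).
split.
- exact: (flip_frame lam_sq_neq F st0).
- move=> i; rewrite /flipc; case: eqP => [->|/eqP ik].
    by rewrite -PJ'; congr (hat _ (P _)); rewrite /facet_vertex !inE eqxx kJ.
  rewrite scalerA divfK ?st0// -PJ; congr (hat _ (P _)).
  by rewrite /facet_vertex !inE (negPf ik).
- move=> i; rewrite /flipd; case: eqP => [->|/eqP ik].
    by rewrite -PJ; congr (hat _ (P _)); rewrite /facet_vertex !inE eqxx (negPf kJ).
  rewrite scalerA mulfK ?st0// -PJ'; congr (hat _ (P _)).
  by rewrite /facet_vertex !inE (negPf ik).
- move=> i; case: eqP => [->|/eqP ik]; first by rewrite !vertex_signU1k// (sg k).1 (sg k).2.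
  rewrite !vertex_signU1// (sgrM (al i)) (sgrM (be i)) sgrV (sgr_stretch F PJ)// (sg i).1 (sg i).2.
  by case: (k < i)%N; rewrite /= ?expr1 ?expr0 ?invrN ?invr1.
- rewrite det_basis_flip// facet_signU1// big_setU1//= -or.
  rewrite (bigD1 k)//= eqxx (eq_bigr (fun i => al i / stretch X lam N k i)); last first.
    by move=> i /negPf ->.
  rewrite big_split /= prodfV [\prod_i al i](bigD1 k)//=.
  set S := \prod_(i | i != k) stretch X lam N k i; set Q := \prod_(i | i != k) al i.
  have S0 : S != 0 by apply/prodf_neq0 => i; exact: st0.
  have -> : s k * s' k = Num.sg (be k) * Num.sg (al k).
    rewrite (sg k).1 (sg k).2 /vertex_sign (negPf kJ) mulrACA -expr2 sqrr_sign mulr1.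
    by rewrite mulrC.
  rewrite -!sgrM.
  transitivity (Num.sg (be k * (al k)^-1 *
    (o * facet_sign R J * (al k * Q) * \det (basis_mx X c M)))).
    by congr Num.sg; field; rewrite al0 S0.
  by rewrite !sgrM sgrV.
Qed.

Lemma frame_at_all J : frame_at finset.set0 -> frame_at J.
Proof.
move=> f0; move: {2}#|J| (erefl #|J|) => m; elim: m J => [|m IH] J Jm.
  by move/eqP: Jm; rewrite cards_eq0 => /eqP ->.
have /card_gt0P[k kJ] : (0 < #|J|)%N by rewrite Jm.
rewrite -(finset.setD1K kJ); apply: frame_atU1; first by rewrite !inE eqxx.
by apply: IH; move: Jm; rewrite (cardsD1 k) kJ => -[].
Qed.
End Walk.

(** * The dihedral angle in terms of a frame *)

Lemma gradD (R : realType) X n (f g : 'rV[R]_(1 + n)) :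
  grad (f + g) = grad f + grad g :> ambient R X n.
Proof. by rewrite /grad; case: X => /=; rewrite ?linearD// /sharp mulmxDl. Qed.

Lemma gradZ (R : realType) X n a (f : 'rV[R]_(1 + n)) :
  grad (a *: f) = a *: grad f :> ambient R X n.
Proof. by rewrite /grad; case: X => /=; rewrite ?linearZ// /sharp -scalemxAl. Qed.

Lemma mem_ridge n (J : {set 'I_n}) k v :
  reflect (exists2 i, i != k & v = facet_vertex J i) (v \in facet J :\ facet_vertex J k).
Proof.
rewrite finset.in_setD1; apply: (iffP andP) => [[vk /mem_facet[i vi]]|[i ik ->]].
  by exists i => //; apply: contraNneq vk => <-; rewrite vi.
by rewrite (inj_eq (@facet_vertex_inj _ J)) facet_vertexP.
Qed.

Section Angle.
Variables (R : realType) (X : geometry) (n : nat).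
Notation V := (ambient R X n).
Notation W := 'rV[R]_(1 + n).
Variables (lam : 'I_n -> R) (u : option R).
Variables (s s' : 'I_n -> R) (P : vertex n -> V) (o : R).
Hypothesis lam_gt0 : forall i, 0 < lam i.
Hypothesis lam_incr : forall i j : 'I_n, (i < j)%N -> lam i < lam j.
Hypothesis ss : forall i, (s i = 1 \/ s i = -1) /\ (s' i = 1 \/ s' i = -1).
Hypothesis Pin : forall v, in_space (P v).
Hypothesis Hn : (3 <= n)%N \/ X = Sph.
Hypothesis n1 : (1 < n)%N.
Hypothesis o0 : o != 0.

(** All three normals are combinations of [grad (N k)] and [grad M]; the normal in
    the second facet is given by the flip at [k] of the frame of the first
    one. *)
Lemma angle_at (J1 J2 : {set 'I_n}) k x psi :
  frame_at lam u s s' P o J1 ->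
  (forall i, (i \in J2) = (i \in J1) (+) (i == k)) ->
  hull P (facet J1 :\ facet_vertex J1 k) x ->
  (exists w n1 n2 : V,
    [/\ exterior_normal P o J1 x w,
        inner_normal P (facet J1 :\ facet_vertex J1 k) (facet J1) x n1,
        inner_normal P (facet J1 :\ facet_vertex J1 k) (facet J2) x n2
      & n2 = cos psi *: n1 - sin psi *: w]) <->
  cos psi = s k * s' k * (1 - coef_n (lam k) u) /\
  sin psi = \prod_(j in J1) (s j * s' j) * vertex_sign s' s J1 k * coef_m (lam k) u.
Proof.
move=> [c [d [N [M [al [be [F PJ PJ' sg or]]]]]]] J2E hx.
have st0 i : i != k -> stretch X lam N k i != 0 :=
  stretch_neq0 lam_gt0 lam_incr Pin Hn F PJ (k := k).
have F2 := flip_frame (lam_sq_neq lam_gt0 lam_incr) F st0.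
pose al2 i := if i == k then be k else al i / stretch X lam N k i.
have al0 i : al i != 0.
  by rewrite -sgr_eq0 (sg i).1 vertex_sign_neq0//; case: (ss i).
have be0 i : be i != 0.
  by rewrite -sgr_eq0 (sg i).2 vertex_sign_neq0//; case: (ss i).
have al20 i : al2 i != 0.
  by rewrite /al2; have [_|ik] := eqVneq i k; [exact: be0 | rewrite mulf_neq0// invr_eq0 st0].
have PJ2 i : hat 1 (P (facet_vertex J2 i)) = al2 i *: flipc X lam c d N k i.
  rewrite /al2 /flipc; case: eqP => [->|/eqP ik].
    by rewrite -PJ'; congr (hat _ (P _)); rewrite /facet_vertex J2E eqxx !inE addbT.
  rewrite scalerA divfK ?st0// -PJ; congr (hat _ (P _)).
  by rewrite /facet_vertex J2E (negPf ik) addbF.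
have ridgeE : facet J1 :\ facet_vertex J1 k = facet J2 :\ facet_vertex J2 k.
  apply/setP => v; apply/mem_ridge/mem_ridge => -[i ik ->]; exists i => //;
    by rewrite /facet_vertex J2E (negPf ik) addbF.
have xs : in_space x by case: hx.
have xM : pairing (hat 1 x) M = 0.
  by have [|] := facet_point F PJ _ hx; first exact: subD1set.
have ext w := exterior_normalE F al0 PJ w n1 o0 xs xM.
have in1 w := inner_normalE F al0 PJ w hx.
have hx2 : hull P (facet J2 :\ facet_vertex J2 k) x by rewrite -ridgeE.
have in2 w := inner_normalE F2 al20 PJ2 w hx2.
rewrite ridgeE in in1 *; set C := 1 - _; set B := coef_m _ _.
have fN : grad (flipN X lam u N M k k) = C *: grad (N k) + B *: grad M :> V.
  by rewrite /flipN eqxx /flipNk gradD !gradZ.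
have NN : dotp (grad (N k) : V) (grad (N k)) = 1 by rewrite -cometric_grad (ff_NN F).
have NM : dotp (grad (N k) : V) (grad M) = 0 by rewrite -cometric_grad (ff_NM F).
have MM : dotp (grad M : V) (grad M) = 1 by rewrite -cometric_grad (ff_MM F).
have ab : vertex_sign s s' J1 k * vertex_sign s' s J1 k = s k * s' k.
  rewrite /vertex_sign mulrACA -[X in _ * X]expr2 sqrr_sign mulr1.
  by case: ifP => _ //; rewrite mulrC.
set e := \prod_(j in J1) _ in or *.
have ee : e * e = 1.
  rewrite /e -big_split /= big1// => j _; rewrite mulrACA.
  by rewrite (sign_sqr (ss j).1) (sign_sqr (ss j).2) mulr1.
set a := vertex_sign s s' J1 k in ab *; set b := vertex_sign s' s J1 k in ab *.
have sE (r r' : 'I_n -> R) : (r k = 1 \/ r k = -1) -> (r' k = 1 \/ r' k = -1) ->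
    vertex_sign r r' J1 k * vertex_sign r r' J1 k = 1.
  move=> h h'; rewrite /vertex_sign mulrACA -[X in _ * X]expr2 sqrr_sign mulr1.
  by case: ifP => _; apply: sign_sqr.
have aa : a * a = 1 by apply: sE; case: (ss k).
have bb : b * b = 1 by apply: sE; case: (ss k).
have vecE p q p' q' : p *: grad (N k) + q *: grad M = p' *: grad (N k) + q' *: grad M :> V <->
    p = p' /\ q = q'.
  split=> [h|[-> ->]//]; split.
    have := congr1 (fun z => dotp z (grad (N k))) h.
    by rewrite /= !dotpDl !dotpZl NN [dotp (grad M) _]dotpC NM !mulr1 !mulr0 !addr0.
  have := congr1 (fun z => dotp z (grad M)) h.
  by rewrite /= !dotpDl !dotpZl MM NM !mulr1 !mulr0 !add0r.
transitivity (b *: (C *: grad (N k) + B *: grad M) =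
   cos psi *: (a *: grad (N k)) - sin psi *: (- e *: grad M) :> V).
  split=> [[w [m1 [m2 [/ext -> /in1 -> /in2 ->]]]]|h].
    by rewrite fN or /al2 eqxx (sg k).1 (sg k).2.
  exists (- e *: grad M), (a *: grad (N k)), (b *: (C *: grad (N k) + B *: grad M)); split=> //.
  - by apply/ext; rewrite or.
  - by apply/in1; rewrite (sg k).1.
  - by apply/in2; rewrite fN /al2 eqxx (sg k).2.
rewrite scalerDr !scalerA -scaleNr vecE.
split=> [[h1 h2]|[-> ->]].
  split.
    by rewrite -ab; transitivity (a * (cos psi * a)); [rewrite mulrCA aa mulr1 | rewrite -h1; ring].
  by rewrite -[LHS]mul1r -ee; transitivity (e * - (sin psi * - e)); [ring | rewrite -h2; ring].
split.
  by rewrite -ab; transitivity (a * a * b * C); [rewrite aa; ring | ring].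
by transitivity (e * e * b * B); [rewrite ee; ring | ring].
Qed.

End Angle.

Section Signs.
Variables (R : realType) (n : nat) (s s' : 'I_n -> R).
Hypothesis ss : forall i, (s i = 1 \/ s i = -1) /\ (s' i = 1 \/ s' i = -1).

(** The first factor comes from the exterior normal, the second one from the sign
    of the vertex number [k]; for each [j \in J] their product is -1 exactly
    when [j] lies in the set X_k. *)
Lemma Xset_sign (J : {set 'I_n}) (k : 'I_n) : k \notin J ->
  \prod_(j in J) (s j * s' j) * (-1) ^+ #|[set j in J | (j < k)%N]| =
  (-1) ^+ #|J :&: Xset s s' k|.
Proof.
move=> kJ.
have cardE (A : {set 'I_n}) : A \subset J ->
    (-1) ^+ #|A| = \prod_(j in J) (if j \in A then -1 else 1) :> R.
  move=> AJ; rewrite -prodr_const big_mkcond [RHS]big_mkcond; apply: eq_bigr => j _.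
  by case: (boolP (j \in A)) => [/(fintype.subsetP AJ) ->|_]; rewrite ?if_same.
rewrite !cardE.
- rewrite -big_split; apply: eq_bigr => j jJ; rewrite /Xset !inE jJ /=.
  have jk : j != k by apply: contraNneq kJ => <-.
  have ssj : s j * s' j = 1 \/ s j * s' j = -1.
    by case: (ss j) => -[]-> []->; rewrite ?mulrNN ?mulr1 ?mul1r; [left | right | right | left].
  have m11 : (-1 == 1 :> R) = false by apply/negbTE; rewrite lt_eqF// ltrN10 // ltr01.
  have m12 : (1 == -1 :> R) = false by rewrite eq_sym.
  by case: ltngtP jk => [jk _|kj _|/val_inj ->]; rewrite ?eqxx//;
    case: ssj => ->; rewrite ?eqxx ?m11 ?m12 ?mulrNN ?mulr1 ?mul1r.
- exact: subsetIl.
- by apply/fintype.subsetP => j; rewrite !inE => /andP[].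
Qed.
End Signs.

(** * Angles modulo 2 pi *)

Section Trig.
Variable R : realType.
Implicit Types a b : R.

Lemma cos_eq1_2pi a : 0 <= a < 2 * pi -> cos a = 1 -> a = 0.
Proof.
move=> /andP[a0 a2] ca.
have p0 := pi_gt0 R.
have inj (y : R) : 0 <= y <= pi -> cos y = 1 -> y = 0.
  by move=> yp cy; apply: cos_inj; rewrite ?in_itv/= ?lexx ?(ltW p0) ?cos0.
have [ap|pa] := leP a pi; first by apply: inj; rewrite ?a0.
have : 2 * pi - a = 0.
  apply: inj; first by apply/andP; split; lra.
  have -> : 2 * pi - a = - a + pi *+ 2 by ring.
  by rewrite cosD2pi cosN.
by lra.
Qed.

Lemma cosD2piz a (z : int) : cos (a + 2 * pi * z%:~R) = cos a.
Proof.
have nat_case (k : nat) b : cos (b + 2 * pi * k%:R) = cos b.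
  by rewrite -[RHS](periodicn (@cosD2pi R) k b) mulr_natl mulr_natr.
case: (intP z) => [|k|k]; first by rewrite mulr0 addr0.
  exact: nat_case.
rewrite -[LHS](nat_case k.+1); congr cos.
by rewrite mulrNz; ring.
Qed.

Lemma sinD2piz a (z : int) : sin (a + 2 * pi * z%:~R) = sin a.
Proof. by rewrite -!cosBpihalf addrAC cosD2piz. Qed.

Lemma cos_sin_eq a b :
  (cos a = cos b /\ sin a = sin b) <-> exists z : int, a = b + 2 * pi * z%:~R.
Proof.
split=> [[ec es]|[z ->]]; last by rewrite cosD2piz sinD2piz.
have p0 : 0 < 2 * pi :> R by rewrite mulr_gt0// pi_gt0.
pose z := Num.floor ((a - b) / (2 * pi)); exists z.
have c1 : cos (a - b - 2 * pi * z%:~R) = 1.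
  rewrite -mulrN -mulrNz cosD2piz cosB ec es -!expr2.
  exact: cos2Dsin2.
have : a - b - 2 * pi * z%:~R = 0.
  apply: cos_eq1_2pi c1.
  have /andP[h1 h2] := floor_itv ((a - b) / (2 * pi)).
  rewrite intrD -(ltr_pM2r p0) in h2; rewrite -(ler_pM2r p0) in h1.
  move: h1 h2; rewrite -/z divfK ?gt_eqF// => h1 h2.
  by apply/andP; split; lra.
by lra.
Qed.

Lemma phi_cos_sin (l : R) u : cos (phi l u) = 1 - coef_n l u /\ sin (phi l u) = coef_m l u.
Proof.
case: u => [v|] /=; last by rewrite cospi sinpi; split; ring.
set t := l * v; have tE : tan (atan t) = t := atanK t.
have c0 : cos (atan t) != 0.
  by rewrite gt_eqF// cos_gt0_pihalf// atan_gtNpi2 atan_ltpi2.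
have sE : sin (atan t) = t * cos (atan t) by rewrite -{2}tE /tan divfK.
have c2 : cos (atan t) ^+ 2 = (t ^+ 2 + 1)^-1.
  by rewrite -[LHS]invrK; congr (_^-1); rewrite cos2_tan2// tE addrC.
rewrite mulr_natl cos_mulr2n sin_mulr2n sE.
have -> : cos (atan t) * (t * cos (atan t)) = t * cos (atan t) ^+ 2 by ring.
rewrite c2 /t.
by split; field; exact: sq1_neq0.
Qed.
End Trig.

(** * Proof of the theorem *)

Lemma vertex_in_hull (R : realType) X n (P : vertex n -> ambient R X n) (A : {set vertex n}) v :
  in_space (P v) -> v \in A -> hull P A (P v).
Proof.
move=> vin vA; split=> //; exists (fun w => (w == v)%:R); split=> [|w]; last by rewrite ler0n.
apply/point_coordE; split=> [w wA|].
  by rewrite (_ : (w == v) = false)//; apply: contraNF wA => /eqP ->.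
rewrite (bigD1 v)//= eqxx scale1r big1 ?addr0// => w /negPf ->.
by rewrite scale0r.
Qed.

Lemma facet_vertex0 n (i : 'I_n) : facet_vertex finset.set0 i = inl i.
Proof. by rewrite /facet_vertex inE. Qed.

Lemma vertex_sign0 (R : realType) n (r r' : 'I_n -> R) i :
  vertex_sign r r' finset.set0 i = r i.
Proof.
rewrite /vertex_sign inE (_ : [set j in finset.set0 | _] = finset.set0).
  by rewrite cards0 mulr1.
by apply/setP => j; rewrite !inE.
Qed.

(** The orientation is adapted to [m], which is the gradient of [M]; this fixes
    the sign of the determinant of the frame. *)
Lemma frame_at0 (R : realType) X n (lam : 'I_n -> R) u s s' (m : ambient R X n) P o :
  (1 < n)%N -> (forall v, in_space (P u v)) ->
  (forall i, (s i = 1 \/ s i = -1) /\ (s' i = 1 \/ s' i = -1)) ->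
  base_frame lam u s s' m P -> adapted_orientation m (P u) o ->
  frame_at lam u s s' (P u) o finset.set0.
Proof.
move=> n1 Pin ss [c [d [N [M [al [be [F gM Pa Pb sg]]]]]]] [oE Ho].
have Pa0 i : hat 1 (P u (facet_vertex finset.set0 i)) = al i *: c i by rewrite facet_vertex0.
exists c, d, N, M, al, be; split=> //.
- by move=> i; rewrite -Pb; congr (hat _ (P u _)); rewrite /facet_vertex !inE.
- by move=> i; rewrite !vertex_sign0.
have n0 : (0 < n)%N by exact: ltnW.
rewrite big_set0; set K := o * _ * _ * _.
have al0 i : al i != 0.
  by rewrite -sgr_eq0 (sg i).1; case: (ss i) => -[->|->] _; rewrite ?oppr_eq0 oner_eq0.
have o0 : o != 0 by case: oE => ->; rewrite ?oppr_eq0 oner_eq0.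
pose v : vertex n := inl (Ordinal n0); pose x := P u v.
have vA : v \in facet finset.set0 by rewrite inE /= finset.in_setC finset.in_set0.
have hx : hull (P u) (facet finset.set0) x by exact: vertex_in_hull.
have [xM _] := facet_point F Pa0 (fintype.subxx _) hx.
have := Ho x hx; rewrite /interior_normal => /(exterior_normalE F al0 Pa0 _ n1 o0 (Pin v) xM).
rewrite -/K gM => /(congr1 (fun z => dotp z m)).
have mm : dotp m m = 1 by rewrite -gM -cometric_grad (ff_MM F).
by rewrite -scaleN1r !dotpZl mm !mulr1 => /oppr_inj/esym.
Qed.

Section Ridge.
Variables (n : nat) (I J : {set 'I_n}) (k : 'I_n).
Hypothesis HIJ : [disjoint I & J].
Hypothesis HcardIJ : (#|I| + #|J| = n - 1)%N.
Hypothesis Hk : k \notin I :|: J.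

Lemma face_compl : I :|: J = [set~ k].
Proof.
apply/eqP; rewrite eqEcard; apply/andP; split.
  by apply/fintype.subsetP => i iIJ; rewrite !inE; apply: contraNneq Hk => <-.
by rewrite cardsCs finset.setCK cards1 card_ord -HcardIJ cardsU disjoint_setI0// cards0 subn0.
Qed.

Lemma mem_face_compl i : i != k -> (i \in I) = (i \notin J).
Proof.
move=> ik; have : i \in I :|: J by rewrite face_compl !inE.
rewrite inE; have [iJ _|] := boolP (i \in J); last by rewrite orbF.
by apply/negbTE; apply: contraTN iJ => iI; rewrite (disjointFr HIJ).
Qed.

(** Only the membership of [k] distinguishes the two facets containing a ridge. *)
Lemma face_sub_facet J1 : face I J \subset facet J1 ->
  (forall i, i != k -> (i \in J1) = (i \in J)) /\
  face I J = facet J1 :\ facet_vertex J1 k.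
Proof.
move=> FJ1; have J1E i : i != k -> (i \in J1) = (i \in J).
  move=> ik; have [iJ|iJ] := boolP (i \in J).
    by have := fintype.subsetP FJ1 (inr i); rewrite !inE => ->.
  have iI : i \in I by rewrite mem_face_compl.
  by have := fintype.subsetP FJ1 (inl i); rewrite !inE iI => /(_ isT)/negbTE.
have kI : k \notin I by apply: contra Hk; rewrite !inE => ->.
have kJ : k \notin J by apply: contra Hk; rewrite !inE => ->; rewrite orbT.
split=> //; apply/setP => v; apply/idP/mem_ridge => [|[i ik ->]].
  rewrite inE; case: v => i iF; exists i.
  - by apply: contraNneq kI => <-.
  - have ik : i != k by apply: contraNneq kI => <-.
    by rewrite /facet_vertex J1E// -[i \in J]negbK -mem_face_compl// iF.
  - by apply: contraNneq kJ => <-.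
  - have ik : i != k by apply: contraNneq kJ => <-.
    by rewrite /facet_vertex J1E// iF.
rewrite inE /facet_vertex J1E//; case: ifP => [//|/negbT iJ].
by rewrite mem_face_compl.
Qed.
End Ridge.

Theorem lemma4p1 (R : realType) (X : geometry) (n : nat)
    (G : 'M[R]_n) (lam s s' : 'I_n -> R)
    (nv : 'I_n -> ambient R X n) (m : ambient R X n)
    (P : option R -> vertex n -> ambient R X n)
    (HP : simplest_type G lam s s' nv m P)
    (Hn : (3 <= n)%N \/ (n = 2%N /\ X = Sph))
    (u : option R) (o : R) (Ho : adapted_orientation m (P u) o)
    (I J : {set 'I_n}) (HIJ : [disjoint I & J])
    (HcardIJ : (#|I| + #|J| = n - 1)%N)
    (k : 'I_n) (Hk : k \notin I :|: J) (psi : R) :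
  dihedral_angle (P u) o (face I J) psi <->
  exists z : int,
    psi = (-1) ^+ #|J :&: Xset s s' k| * s k * phi (lam k) u
          + (if s k * s' k == 1 then 0 else pi) + 2 * pi * z%:~R.
Proof.
case: HP => -[[_ Gii] _ _ [lam0 lamI] ss] nvG [mnv mm] HP _.
have n1 : (1 < n)%N by case: Hn => [/ltnW//|[-> _]].
have HnX : (3 <= n)%N \/ X = Sph by case: Hn => [|[]]; [left | right].
have [Pin base] : (forall v, in_space (P u v)) /\ base_frame lam u s s' m P.
  case: (boolP (is_Euc X)) HP => eX HP.
    split; last by apply: euclidean_base HP.
    by move: (P u) eX; clear; case: X.
  have Pin : forall v, in_space (P u v) by case: HP => c [].
  by split=> //; apply: curved_base HP.
have o0 : o != 0 by case: Ho => -[->|->] _; rewrite ?oppr_eq0 oner_eq0.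
have frJ J1 := frame_at_all lam0 lamI ss Pin HnX J1 (frame_at0 n1 Pin ss base Ho).
have kJ : k \notin J by apply: contra Hk; rewrite !inE => ->; rewrite orbT.
have sub := face_sub_facet HIJ HcardIJ Hk.
(* The condition does not depend on which of the two facets comes first. *)
have ang J1 J2 x : face I J \subset facet J1 -> face I J \subset facet J2 -> J1 != J2 ->
    hull (P u) (face I J) x ->
    (exists w n1 n2 : ambient R X n,
      [/\ exterior_normal (P u) o J1 x w, inner_normal (P u) (face I J) (facet J1) x n1,
        inner_normal (P u) (face I J) (facet J2) x n2 & n2 = cos psi *: n1 - sin psi *: w]) <->
    cos psi = s k * s' k * (1 - coef_n (lam k) u) /\
    sin psi = (-1) ^+ #|J :&: Xset s s' k| * s' k * coef_m (lam k) u.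
  move=> /sub[J1E FE] /sub[J2E _] J12; rewrite FE => hx.
  have J2E' i : (i \in J2) = (i \in J1) (+) (i == k).
    have [->|ik] := eqVneq i k; last by rewrite addbF J1E// J2E.
    rewrite addbT; apply: contraNeq J12 => kE.
    have {}kE : (k \in J2) = (k \in J1) by move: kE; do 2!case: (k \in _).
    by apply/eqP/setP => i'; have [->|ik'] := eqVneq i' k; [rewrite kE | rewrite J1E// J2E].
  rewrite (angle_at lam0 lamI ss Pin HnX n1 o0 psi (frJ J1) J2E' hx).
  suff -> : \prod_(j in J1) (s j * s' j) * vertex_sign s' s J1 k =
    (-1) ^+ #|J :&: Xset s s' k| * s' k by [].
  rewrite -Xset_sign// /vertex_sign.
  have -> : [set j in J1 | (j < k)%N] = [set j in J | (j < k)%N].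
    apply/setP => i; rewrite !inE; have [->|ik] := eqVneq i k; first by rewrite ltnn !andbF.
    by rewrite J1E.
  have [kJ1|kJ1] := boolP (k \in J1); last first.
    have -> : J1 = J.
      apply/setP => i; have [->|ik] := eqVneq i k; last by rewrite J1E.
      by rewrite (negPf kJ) (negPf kJ1).
    by ring.
  have -> : J1 = k |: J.
    by apply/setP => i; rewrite in_setU1; have [->|ik] := eqVneq i k; [rewrite kJ1 | rewrite J1E].
  rewrite big_setU1//=; set p := \prod_(i in J) _; set q := (-1) ^+ _.
  transitivity (s k * s k * (p * s' k * q)); first by ring.
  by rewrite (sign_sqr (ss k).1); ring.
have [cphi sphi] := phi_cos_sin (lam k) u.
rewrite -cos_sin_eq; set e := (-1) ^+ _.
have esk : e * s k = 1 \/ e * s k = -1.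
  by rewrite /e -signr_odd; case: (odd _); case: (ss k).1 => ->;
    rewrite ?mulN1r ?opprK ?mul1r; [right|left|left|right].
have cos1 : cos (e * s k * phi (lam k) u) = 1 - coef_n (lam k) u.
  by case: esk => ->; rewrite ?mulN1r ?cosN ?mul1r.
have sin1 : sin (e * s k * phi (lam k) u) = e * s k * coef_m (lam k) u.
  by case: esk => ->; rewrite ?mulN1r ?sinN ?mul1r sphi.
have ssk : s k * s' k = 1 \/ s k * s' k = -1.
  by case: (ss k) => -[]-> []->; rewrite ?mulrNN ?mulr1 ?mul1r; [left | right | right | left].
have m11 : (-1 == 1 :> R) = false by apply/negbTE; rewrite lt_eqF// ltrN10 // ltr01.
have s'k : s' k = (s k * s' k) * s k by rewrite mulrAC (sign_sqr (ss k).1) mul1r.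
have -> : cos (e * s k * phi (lam k) u + (if s k * s' k == 1 then 0 else pi)) =
    s k * s' k * (1 - coef_n (lam k) u).
  by case: ssk => ->; rewrite ?eqxx ?m11 ?addr0 ?cosDpi cos1; ring.
have -> : sin (e * s k * phi (lam k) u + (if s k * s' k == 1 then 0 else pi)) =
    e * s' k * coef_m (lam k) u.
  rewrite [in RHS]s'k; case: ssk => ->; rewrite ?eqxx ?m11 ?addr0 ?sinDpi sin1; ring.
have FJ : face I J \subset facet J.
  apply/fintype.subsetP => -[] i; rewrite !inE// => iI.
  by apply/negP => iJ; rewrite (disjointFr HIJ iI) in iJ.
have FkJ : face I J \subset facet (k |: J).
  have kI : k \notin I by apply: contra Hk; rewrite !inE => ->.
  apply/fintype.subsetP => -[] i; rewrite !inE => iI; last by rewrite iI orbT.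
  apply/norP; split; first by apply: contraNneq kI => <-.
  by apply/negP => iJ; rewrite (disjointFr HIJ iI) in iJ.
split=> [H|H x J1 J2 hx J12 F1 F2]; last by apply/(ang J1 J2).
have [|i] := @exists_notin n [set k]; first by rewrite cards1.
rewrite inE => ik; pose v := facet_vertex J i.
have vF : v \in face I J by rewrite (sub _ FJ).2; apply/mem_ridge; exists i.
have JkJ : J != k |: J.
  by apply: contraNneq kJ => ->; rewrite !inE eqxx.
have hx := vertex_in_hull (Pin v) vF.
by apply/(ang _ _ _ FJ FkJ JkJ hx); exact: H.
Qed.
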